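(* There exist problem-independent constants $C_1,C_2,C_3,C_M,C_\nu,C_s>0$ such that the following holds. Let $r\le d\le n$ be positive integers with $n$ a power of $2$. Suppose that $\epsilon,\delta\in(0,C_3)$, $m,s\in\mathbb{N}^+$ with $m\le n$, and $E>0$ satisfy $$1\le s\le C_sC_2^{-1}\epsilon^{-1}[4r+\log(1/\delta)],$$ $$C_M\le E\le C_2^2\epsilon^2 s\,[4r+\log(1/\delta)]^{-1}e^{C_s(C_2\epsilon s)^{-1}[4r+\log(1/\delta)]},$$ $$m\ge\max\left\{E\,C_2^{-2}\epsilon^{-2}[4r+\log(1/\delta)],\ s\,e\right\}.$$ Let $\delta_1\in(0,1)$ and suppose further that $$n\ge\frac{\left(\sqrt{r}+\sqrt{8\log(n/\delta_1)}\right)^2}{s\,C_\nu^2C_1^{-2}\,\bar\mu(\epsilon,\delta)^2},$$ where $$\bar\mu(\epsilon,\delta)=C_1\sqrt{C_2}\sqrt{\epsilon}\,\min\left\{\frac{\log(E/(C_2\epsilon))}{4r+\log(1/\delta)},\ \sqrt{\frac{\log E}{4r+\log(1/\delta)}}\right\}.$$ Then for any matrix $A\in\mathbb{R}^{n\times d}$ with rank $r$, a Hashed-Randomised-Hadamard-Transform (HRHT) matrix $S=S_hHD\in\mathbb{R}^{m\times n}$, with $S_h$ an $s$-hashing matrix, is an $\epsilon$-subspace embedding for $A$ with probability at least $(1-\delta)(1-\delta_1)$.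
   Context: HRHT: an $m\times n$ random matrix $S=S_hHD$ with $m\le n$, where $D$ is a random $n\times n$ diagonal matrix with independent $\pm1$ (equal probability) diagonal entries; $H$ is the $n\times n$ Walsh–Hadamard matrix $H_{ij}=n^{-1/2}(-1)^{\langle(i-1)_2,(j-1)_2\rangle}$, where $(k)_2$ is the binary representation vector of $k$; and $S_h$ is a random $m\times n$ $s$-hashing matrix independent of $D$. $s$-hashing matrix: independently for each column $j\in\{1,\dots,n\}$, indices $i_1,\dots,i_s\in\{1,\dots,m\}$ are sampled uniformly at random without replacement and the $(i_k,j)$ entry is $\pm1/\sqrt{s}$ (independent signs, equal probability) for $k=1,\dots,s$; all other entries are zero. $S$ is an $\epsilon$-subspace embedding for $A$ if $(1-\epsilon)\|Ax\|_2^2\le\|SAx\|_2^2\le(1+\epsilon)\|Ax\|_2^2$ for all $x\in\mathbb{R}^d$. In the condition on $m$, $e$ is Euler's number. *)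

(* Defs.v *)
From mathcomp Require Import all_boot all_order all_algebra.
From mathcomp Require Import all_classical all_reals all_analysis.

Set Implicit Arguments.
Unset Strict Implicit.
Unset Printing Implicit Defensive.

Import Order.TTheory GRing.Theory Num.Theory.
Import numFieldNormedType.Exports.

Local Open Scope classical_set_scope.
Local Open Scope ring_scope.

(* Euclidean norm: the library's norm on matrices is the sup norm. *)
Definition norm2 (R : realType) (n : nat) (x : 'cV[R]_n) : R :=
  Num.sqrt (\sum_(i < n) x i 0 ^+ 2).

Definition subspace_embedding (R : realType) (m n d : nat) (eps : R)
    (S : 'M[R]_(m, n)) (A : 'M[R]_(n, d)) : Prop :=
  forall x : 'cV[R]_d,
    (1 - eps) * norm2 (A *m x) ^+ 2 <= norm2 (S *m (A *m x)) ^+ 2 /\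
    norm2 (S *m (A *m x)) ^+ 2 <= (1 + eps) * norm2 (A *m x) ^+ 2.

Definition binary_digit (k l : nat) : nat := odd (k %/ 2 ^ l).

(* Rows and columns are indexed from 0, so (i-1)_2 is the binary expansion of
   the ordinal i. For n a power of 2, it has trunc_log 2 n digits. *)
Definition walsh_hadamard (R : realType) (n : nat) : 'M[R]_n :=
  \matrix_(i < n, j < n)
    ((Num.sqrt n%:R)^-1 *
     (-1) ^+ (\sum_(l < trunc_log 2 n) binary_digit i l * binary_digit j l)%N).

(* All random objects below take finitely many values, so laws and
   independence are expressed through point events. *)
Definition uniform_on (R : realType) (disp : measure_display)
    (T : measurableType disp) (P : probability T R) (U : finType)
    (X : T -> U) (A : pred U) : Prop :=
  forall u : U,
    measurable (X @^-1` [set u]) /\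
    P (X @^-1` [set u]) = (if A u then (#|A|%:R)^-1 else 0)%:E.

Definition mutually_independent (R : realType) (disp : measure_display)
    (T : measurableType disp) (P : probability T R) (I : finType) (U : Type)
    (X : I -> T -> U) : Prop :=
  forall (J : {set I}) (u : I -> U),
    P (\bigcap_(i in [set` J]) (X i @^-1` [set u i])) =
    (\prod_(i in J) P (X i @^-1` [set u i]))%E.

Definition independent (R : realType) (disp : measure_display)
    (T : measurableType disp) (P : probability T R) (U V : Type)
    (X : T -> U) (Y : T -> V) : Prop :=
  forall (u : U) (v : V),
    P ((X @^-1` [set u]) `&` (Y @^-1` [set v])) =
    (P (X @^-1` [set u]) * P (Y @^-1` [set v]))%E.

(* The boolean b encodes the sign (-1) ^+ b. *)
Definition random_sign_diagonal (R : realType) (disp : measure_display)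
    (T : measurableType disp) (P : probability T R) (n : nat)
    (D : T -> 'M[R]_n) : Prop :=
  exists sigma : 'I_n -> T -> bool,
    [/\ forall j, uniform_on P (sigma j) predT,
        mutually_independent P sigma
      & forall w, D w = diag_mx (\row_j (-1) ^+ sigma j w)].

(* idx j lists the s row indices drawn for column j: uniform sampling without
   replacement is the uniform law on tuples with distinct entries. These
   entries being almost surely distinct, at most one term of the sum below is
   then nonzero. *)
Definition random_hashing (R : realType) (disp : measure_display)
    (T : measurableType disp) (P : probability T R) (m n s : nat)
    (Sh : T -> 'M[R]_(m, n)) : Prop :=
  exists (idx : 'I_n -> T -> s.-tuple 'I_m) (sgn : 'I_n * 'I_s -> T -> bool),
    [/\ forall j, uniform_on P (idx j) (fun t => uniq t),
        forall jk, uniform_on P (sgn jk) predT,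
        mutually_independent P idx /\ mutually_independent P sgn,
        independent P (fun w => idx^~ w) (fun w => sgn^~ w)
      & forall w, Sh w = \matrix_(i < m, j < n)
          \sum_(k < s | tnth (idx j w) k == i)
            (-1) ^+ sgn (j, k) w / Num.sqrt s%:R].

Definition random_HRHT (R : realType) (disp : measure_display)
    (T : measurableType disp) (P : probability T R) (m n s : nat)
    (S : T -> 'M[R]_(m, n)) : Prop :=
  exists (Sh : T -> 'M[R]_(m, n)) (D : T -> 'M[R]_n),
    [/\ random_hashing P s Sh,
        random_sign_diagonal P D,
        independent P Sh D
      & forall w, S w = Sh w *m walsh_hadamard R n *m D w].

Definition mu_bar (R : realType) (C1 C2 E eps delta : R) (r : nat) : R :=
  C1 * Num.sqrt C2 * Num.sqrt eps *
  Num.min (ln (E / (C2 * eps)) / (4 * r%:R + ln (1 / delta)))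
          (Num.sqrt (ln E / (4 * r%:R + ln (1 / delta)))).

(* Main.v *)
(* The column space of A is R^r up to an isometry W, and an eps-embedding follows
   from |  |S v|^2 - |v|^2 | <= (eps/5) |v|^2 for v in a net of integer points of
   norm at most 2 sqrt r, of which there are at most 64^r.

   A Hoeffding bound makes H D W z flat for all z in the net: its coordinates are
   at most nu |z|, except with probability delta1.  For a flat unit vector y,
   s (|S_h y|^2 - 1) is a quadratic polynomial Q in the signs of S_h without
   diagonal terms, and |Q| is controlled by its moment of even order p, with
   L <= p <= 2 L for L = 4 r + log(1/delta).  Expanding Q^p into monomials shows
   that it only increases when the entries of S_h are replaced by independent ones
   that are nonzero with probability s/m.  Then rows are independent, so
   E Q^p / p! is a coefficient of a product of m truncated exponential generating
   functions.  The moments of one row are bounded by grouping words according to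
   the number l of columns they use: l = 2 uses nu^2 = O(s eps log E / L), and
   l >= 3 uses nu = O(sqrt (s eps) log (E/eps) / L). *)

Require Import Defs.
From mathcomp Require Import all_boot all_order all_algebra.
From mathcomp Require Import all_classical all_reals all_analysis.
From mathcomp Require Import perm ring lra zify.

Set Implicit Arguments.
Unset Strict Implicit.
Unset Printing Implicit Defensive.

Import Order.TTheory GRing.Theory Num.Theory.
Import numFieldNormedType.Exports.

Local Open Scope classical_set_scope.
Local Open Scope ring_scope.

(** * Exponentials, and moments of sums of independent variables *)

(** The obstacle is dependence: sampling without replacement couples the rows of [S_h], so the
    moments of Q do not factor over rows. The comparison with independent entries is possible
    monomial by monomial: random signs kill every odd exponent, and for even ones the probability
    that a column hits all rows of a set is at most (s/m) to the size of that set. Two bounds on nu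
    are needed for the following reason. After summing over word lengths, the words on l columns
    contribute an exponential series in lam nu^2 l^2. Its full sum is quadratic in l in the exponent
    and could not be absorbed by a geometric series in l. Stopping it at order p replaces the
    exponent by 2 l sqrt(lam nu^2 p), linear in l, and powers of X = E / (C2 eps) absorb it. For l =
    2 no power of X is left over and the plain exponential is compared with E. The parameter lam is
    tuned so that Markov's inequality gives exp(-2L), where 2L = 8r + 2 log(1/delta): the 8r pays
    for the 64^r net points. *)

Lemma sum_expR_le (R : realType) (x : R) (N : nat) :
  0 <= x -> \sum_(k < N) x ^+ k / k`!%:R <= expR x.
Proof.
move=> x0; have := @nondecreasing_cvgn_le R (series (exp_coeff x)) _ _ N.
rewrite /series /= big_mkord; apply; last exact: is_cvg_series_exp_coeff.
apply/nondecreasing_seqP => n.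
by rewrite /series/= big_nat_recr//= lerDl exp_coeff_ge0.
Qed.

Lemma exprn_fact_le (R : realType) (x : R) (k : nat) :
  0 <= x -> x ^+ k <= k`!%:R * expR x.
Proof.
move=> x0; rewrite mulrC -ler_pdivrMr ?ltr0n ?fact_gt0//.
apply: le_trans (sum_expR_le k.+1 x0); rewrite big_ord_recr/= lerDr.
by apply: sumr_ge0 => i _; rewrite divr_ge0// exprn_ge0.
Qed.

Lemma fact_le_exp (n : nat) : (n`! <= n ^ n)%N.
Proof.
elim: n => // n IH; rewrite factS expnS leq_mul2l/=.
by apply: leq_trans IH _; case: n => // n; rewrite leq_exp2r.
Qed.

(** Near 0, exp x <= 1/(1-x) makes the mean at most 1/(1 - x^2) <= 1 + 2 x^2; beyond 1/2, x <= 2 x^2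
    is enough. The constant 2, instead of the optimal 1/2, is what puts the 8 in the sign tail. *)
Lemma cosh_le (R : realType) (x : R) :
  (expR x + expR (- x)) / 2 <= expR (2 * x ^+ 2).
Proof.
wlog x0 : x / 0 <= x.
  move=> H; have [/H //|/ltW x0] := leP 0 x.
  by have := H (- x); rewrite oppr_ge0 opprK sqrrN addrC; apply.
have [x1|x1] := leP x (1/2).
  have A : expR x <= (1 - x)^-1.
    rewrite -[x in expR x]opprK expRN lef_pV2 ?posrE ?expR_gt0//; last lra.
    by have := expR_ge1Dx (- x).
  have B : expR (- x) <= (1 + x)^-1.
    rewrite expRN lef_pV2 ?posrE ?expR_gt0//; last lra.
    exact: expR_ge1Dx.
  have C := expR_ge1Dx (2 * x ^+ 2).
  apply: le_trans C.
  apply: (@le_trans _ _ (((1 - x)^-1 + (1 + x)^-1) / 2)); first by lra.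
  have -> : ((1 - x)^-1 + (1 + x)^-1) / 2 = (1 - x ^+ 2)^-1.
    by field; rewrite !lt0r_neq0 //; nra.
  have x2 : x ^+ 2 <= 1/4 by nra.
  have x2' : 0 <= x ^+ 2 by nra.
  by rewrite -[leLHS]mul1r ler_pdivrMr; nra.
have : expR (- x) <= expR x by rewrite ler_expR; lra.
have : expR x <= expR (2 * x ^+ 2) by rewrite ler_expR; nra.
lra.
Qed.

Definition trunc_exp (R : realType) (N : nat) (a : R) : {poly R} :=
  \poly_(k < N.+1) (a ^+ k / k`!%:R).

(** Up to degree [N] truncation is invisible, so these coefficients obey exp(aX) exp(bX) =
    exp((a+b)X), which is the binomial theorem. *)
Lemma coef_prod_trunc_exp (R : realType) (I : Type) (s : seq I) (N : nat)
    (g : I -> R) (k : nat) : (k <= N)%N ->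
  (\prod_(i <- s) trunc_exp N (g i))`_k = (\sum_(i <- s) g i) ^+ k / k`!%:R.
Proof.
elim: s k => [|i s IH] k kN.
  rewrite !big_nil coef1 expr0n; case: k kN => [|k] _ /=; last by rewrite mul0r.
  by rewrite fact0 invr1 mulr1.
rewrite !big_cons coefM addrC exprDn mulr_suml; apply: eq_bigr => -[j /= jk] _.
rewrite IH ?coef_poly; last by lia.
rewrite ifT; last by lia.
have f0 n : n`!%:R != 0 :> R by rewrite pnatr_eq0 -lt0n fact_gt0.
have <- := @bin_fact k j; last by lia.
have B0 : 'C(k, j)%:R != 0 :> R by rewrite pnatr_eq0 -lt0n bin_gt0; lia.
rewrite !natrM -mulr_natr; field.
by rewrite !f0.
Qed.

Lemma coef_le_horner (R : realType) (p : {poly R}) (x : R) (k : nat) :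
  0 <= x -> (forall i, 0 <= p`_i) -> p`_k * x ^+ k <= p.[x].
Proof.
move=> x0 p0; rewrite horner_coef.
have [kp|kp] := ltnP k (size p); last first.
  by rewrite nth_default// mul0r sumr_ge0// => i _; rewrite mulr_ge0// exprn_ge0.
rewrite (bigD1 (Ordinal kp))//= lerDl sumr_ge0// => i _.
by rewrite mulr_ge0// exprn_ge0.
Qed.

Lemma coefX_ge0 (R : realType) (p : {poly R}) (m k : nat) :
  (forall i, 0 <= p`_i) -> 0 <= (p ^+ m)`_k.
Proof.
move=> p0; elim: m k => [|m IH] k; first by rewrite expr0 coef1 ler0n.
by rewrite exprS coefM sumr_ge0// => i _; rewrite mulr_ge0.
Qed.

(* The p-th power of the sum is p! times the coefficient of 'X^p in a product
   of truncated exponentials, and nonnegative coefficients are bounded by the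
   value at lam; truncation discards the moments of order > p. *)
Lemma moment_iid_sum_le (R : realType) (X : finType) (w g : X -> R)
    (m p : nat) (lam : R) :
  0 < lam -> (forall k, 0 <= \sum_x w x * g x ^+ k) ->
  \sum_(f : {ffun 'I_m -> X}) (\prod_i w (f i)) * (\sum_i g (f i)) ^+ p <=
  p`!%:R / lam ^+ p *
    (\sum_(k < p.+1) lam ^+ k * (\sum_x w x * g x ^+ k) / k`!%:R) ^+ m.
Proof.
move=> lam0 mu0.
have f0 n : n`!%:R != 0 :> R by rewrite pnatr_eq0 -lt0n fact_gt0.
pose M : {poly R} := \sum_x w x *: trunc_exp p (g x).
have Mk k : M`_k = if (k < p.+1)%N then (\sum_x w x * g x ^+ k) / k`!%:R else 0.
  rewrite coef_sum; under eq_bigr do rewrite coefZ coef_poly.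
  case: ltnP => _; last by rewrite big1// => x _; rewrite mulr0.
  by rewrite mulr_suml; apply: eq_bigr => x _; rewrite mulrA.
have M0 k : 0 <= M`_k.
  by rewrite Mk; case: ifP => // _; rewrite divr_ge0.
have -> : \sum_(f : {ffun 'I_m -> X})
    (\prod_i w (f i)) * (\sum_i g (f i)) ^+ p = p`!%:R * (M ^+ m)`_p.
  have -> : M ^+ m = \prod_(i < m) M by rewrite prodr_const card_ord.
  rewrite bigA_distr_bigA/= coef_sum mulr_sumr; apply: eq_bigr => f _.
  rewrite scaler_prod coefZ coef_prod_trunc_exp//=.
  by rewrite mulrCA; congr (_ * _); rewrite mulrCA mulfV ?mulr1.
rewrite -mulrA ler_wpM2l// mulrC ler_pdivlMr ?exprn_gt0//.
have -> : \sum_(k < p.+1) lam ^+ k * (\sum_x w x * g x ^+ k) / k`!%:R = M.[lam].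
  rewrite (@horner_coef_wide _ p.+1); last first.
    by apply/leq_sizeP => j pj; rewrite Mk ltnNge pj.
  by apply: eq_bigr => -[k kp] _ /=; rewrite Mk kp; ring.
rewrite -hornerXn -[in leRHS]horner_exp; apply: le_trans (coef_le_horner p (ltW lam0) _).
  by rewrite hornerXn.
by move=> i; exact: coefX_ge0.
Qed.

(** * Monomials in the entries of a hashing matrix *)

(** Negative correlation of sampling without replacement, written without division. The points of
    [S] are added one at a time; a transposition shows that all points outside [S'] are equally
    likely to be drawn next to [S']. *)
Lemma card_uniq_tuple_contains (m s : nat) (S : {set 'I_m}) : (s <= m)%N ->
  (#|[pred t : s.-tuple 'I_m | uniq t & [forall i in S, i \in t]]| * m ^ #|S| <=
   s ^ #|S| * #|[pred t : s.-tuple 'I_m | uniq t]|)%N.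
Proof.
move=> sm; move: {2}#|S| (erefl #|S|) => l.
elim: l S => [|l IH] S Sl.
  by rewrite Sl !expn0 muln1 mul1n subset_leq_card//; apply/fintype.subsetP => t /andP[].
have [i iS] : exists i, i \in S by apply/set0Pn; rewrite -card_gt0 Sl.
pose S' := S :\ i.
have S'l : #|S'| = l by move: (cardsD1 i S); rewrite iS Sl /S'; lia.
have lm : (l < m)%N by rewrite -Sl -[leqRHS]card_ord max_card.
pose N' := #|[pred t : s.-tuple 'I_m | uniq t & [forall i in S', i \in t]]|.
pose c (a : 'I_m) := #|[pred t : s.-tuple 'I_m |
  uniq t && [forall i in S', i \in t] & a \in t]|.
have cE a b : a \notin S' -> b \notin S' -> (c a <= c b)%N.
  move=> aS bS; rewrite /c.
  pose h (t : s.-tuple 'I_m) := [tuple of map (tperm a b) t].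
  have hI : injective h.
    move=> t t' /(congr1 val)/= /(inj_map (@perm_inj _ _)) tt'; exact: val_inj.
  rewrite -(card_imset _ hI); apply: subset_leq_card; apply/fintype.subsetP => _ /imsetP[t + ->].
  rewrite !inE => /andP[/andP[ut /forall_inP St] at_].
  rewrite map_inj_uniq ?ut/=; last exact: perm_inj.
  apply/andP; split; last by apply/mapP; exists a; rewrite ?tpermL.
  apply/forall_inP => x xS.
  apply/mapP; exists x; first by rewrite St.
  by rewrite tpermD//; [apply: contraNneq aS => ->|apply: contraNneq bS => ->].
(* Double counting of the pairs (t, a) where [t] contains [S'] and [a] is an entry of [t] outside
   [S']. *)
have key : ((m - l) * c i = (s - l) * N')%N.
  have -> : ((m - l) * c i = \sum_(a in ~: S') c a)%N.
    rewrite (eq_bigr (fun=> c i)).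
      by rewrite sum_nat_const; congr (_ * _)%N; rewrite cardsCs finset.setCK card_ord S'l.
    move=> a; rewrite inE => aS; have iS' : i \notin S' by rewrite !inE eqxx.
    by apply/eqP; rewrite eqn_leq !cE.
  rewrite /c; under eq_bigr do rewrite -sum1_card.
  rewrite (@exchange_big_dep _ _ _ _ _ _ _ _ _
    [pred t : s.-tuple 'I_m | uniq t & [forall i in S', i \in t]])/=; last first.
    by move=> a t _ /andP[/andP[-> ->]].
  rewrite mulnC /N' -sum_nat_const; apply: eq_bigr => t /andP[ut St].
  rewrite (eq_bigl [in [predD [in t] & S']]); last by move=> a; rewrite !inE ut St.
  rewrite sum1_card -S'l -[X in (X - _)%N](size_tuple t) -(card_uniqP ut).
  rewrite -(cardID [in S'] [in t]) (@eq_card _ [predI [in t] & [in S']] [in S']).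
    by rewrite addKn; apply: eq_card => a; rewrite !inE.
  move=> a; rewrite [LHS]inE /=; case: (boolP (a \in S')) => [aS|_].
    by rewrite (forall_inP St a aS).
  by rewrite andbF.
have {}IH := IH S' S'l; rewrite S'l -/N' in IH.
have -> : #|[pred t : s.-tuple 'I_m | uniq t & [forall i in S, i \in t]]| = c i.
  apply: eq_card => t; rewrite !inE -andbA; congr (_ && _).
  apply/forall_inP/andP => [H|[/forall_inP H it] a aS].
    split; last exact: H.
    by apply/forall_inP => a; rewrite !inE => /andP[_]; exact: H.
  by have [->//|ai] := eqVneq a i; apply: H; rewrite !inE ai.
(* This is (s - l)/(m - l) <= s/m, from s <= m. *)
have cN : (c i * m <= s * N')%N.
  rewrite -(@leq_pmul2l (m - l)) ?subn_gt0// !mulnA key mulnAC leq_mul2r.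
  by apply/orP; right; rewrite mulnBl mulnBl mulnC leq_sub2l// leq_mul2l sm orbT.
rewrite Sl !expnS mulnA; apply: leq_trans (leq_mul cN (leqnn _)) _.
by rewrite -!mulnA leq_mul2l IH orbT.
Qed.

Lemma sum_prod_ffun (R : realType) (I J : finType) (F : I -> J -> R) :
  \sum_(f : {ffun I -> J}) \prod_i F i (f i) = \prod_i \sum_j F i j.
Proof. by rewrite bigA_distr_bigA. Qed.

(* The entries of a hashing matrix, up to the factor 1 / sqrt s. *)
Definition hash_entry (R : realType) (m n s : nat)
    (t : {ffun 'I_n -> s.-tuple 'I_m}) (b : {ffun 'I_n * 'I_s -> bool})
    (u : 'I_m * 'I_n) : R :=
  \sum_(k < s | tnth (t u.2) k == u.1) (-1) ^+ b (u.2, k).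

Definition tuple_weight (R : realType) (m s : nat) (t : s.-tuple 'I_m) : R :=
  if uniq t then (#|[pred t : s.-tuple 'I_m | uniq t]|%:R)^-1 else 0.

(** Joint law of index tuples and signs. Expectations stay finite weighted sums over realizations
    until the last probabilistic step. *)
Definition hash_weight (R : realType) (m n s : nat)
    (t : {ffun 'I_n -> s.-tuple 'I_m}) (b : {ffun 'I_n * 'I_s -> bool}) : R :=
  (\prod_j tuple_weight R (t j)) * (\prod_(u : 'I_n * 'I_s) 2^-1).

Lemma tuple_weight_ge0 (R : realType) (m s : nat) (t : s.-tuple 'I_m) :
  0 <= tuple_weight R t.
Proof. by rewrite /tuple_weight; case: ifP => // _; rewrite invr_ge0. Qed.

Lemma hash_weight_ge0 (R : realType) (m n s : nat)
    (t : {ffun 'I_n -> s.-tuple 'I_m}) (b : {ffun 'I_n * 'I_s -> bool}) :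
  0 <= hash_weight R t b.
Proof.
apply: mulr_ge0; apply: prodr_ge0 => j _; first exact: tuple_weight_ge0.
by rewrite invr_ge0.
Qed.

Lemma sum_bool_half (R : realType) (U : finType) :
  \sum_(b : {ffun U -> bool}) \prod_(u : U) (2^-1 : R) = 1.
Proof.
rewrite (sum_prod_ffun (fun _ _ => 2^-1)) big1// => u _.
by rewrite big_bool/=; lra.
Qed.

Lemma tuple_weight_contains (R : realType) (m s : nat) (S : {set 'I_m}) :
  (s <= m)%N -> (0 < m)%N ->
  \sum_(t : s.-tuple 'I_m) tuple_weight R t * [forall i in S, i \in t]%:R <=
  (s%:R / m%:R) ^+ #|S|.
Proof.
move=> sm m0; set N := #|[pred t : s.-tuple 'I_m | uniq t]|.
have -> : \sum_(t : s.-tuple 'I_m) tuple_weight R t * [forall i in S, i \in t]%:R =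
    #|[pred t : s.-tuple 'I_m | uniq t & [forall i in S, i \in t]]|%:R / N%:R.
  rewrite -sum1_card natr_sum mulr_suml [RHS]big_mkcond/=; apply: eq_bigr => t _.
  rewrite /tuple_weight -/N inE; case: (uniq t) => /=; last by rewrite mul0r.
  by case: [forall _ in _, _]; rewrite ?mulr1 ?mulr0 ?mul1r.
have [N0|N0] := posnP N.
  by rewrite N0 invr0 mulr0 exprn_ge0// divr_ge0.
rewrite ler_pdivrMr ?ltr0n// exprMn exprVn mulrAC ler_pdivlMr ?exprn_gt0 ?ltr0n//.
by rewrite -!natrX -!natrM ler_nat card_uniq_tuple_contains.
Qed.

(** A slot of a column lands in one row only, so negating the signs of the slots that land in [u]
    negates that entry and fixes all others. This involution is what cancels the monomials with an
    odd exponent. *)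
Lemma hash_entry_flip (R : realType) (m n s : nat)
    (t : {ffun 'I_n -> s.-tuple 'I_m}) (b : {ffun 'I_n * 'I_s -> bool})
    (u v : 'I_m * 'I_n) :
  hash_entry R t [ffun z => b z (+) ((z.1 == u.2) && (tnth (t u.2) z.2 == u.1))] v =
  (-1) ^+ (v == u) * hash_entry R t b v.
Proof.
rewrite mulr_sumr; apply: eq_bigr => k /eqP tk; rewrite ffunE /= signr_addb mulrC.
congr (_ ^+ _ * _).
case: u v tk => [i j] [i' j'] /= <-; rewrite xpair_eqE.
by have [->|_] := eqVneq j' j; rewrite ?andbT ?andbF.
Qed.

Lemma hash_monomial_odd (R : realType) (m n s : nat)
    (t : {ffun 'I_n -> s.-tuple 'I_m}) (a : 'I_m * 'I_n -> nat) (u : 'I_m * 'I_n) :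
  odd (a u) ->
  \sum_(b : {ffun 'I_n * 'I_s -> bool}) \prod_v hash_entry R t b v ^+ a v = 0.
Proof.
move=> ou; set S := LHS.
suff : S = - S by lra.
pose h (b : {ffun 'I_n * 'I_s -> bool}) : {ffun 'I_n * 'I_s -> bool} :=
  [ffun z => b z (+) ((z.1 == u.2) && (tnth (t u.2) z.2 == u.1))].
have hK : involutive h by move=> b; apply/ffunP => z; rewrite !ffunE addbK.
rewrite {1}/S (reindex_inj (can_inj hK))/= /S -sumrN; apply: eq_bigr => b _.
under eq_bigr do rewrite hash_entry_flip exprMn.
rewrite big_split/= (bigD1 u)//= eqxx -exprM mul1n -signr_odd ou expr1.
rewrite big1 ?mulr1 ?mulN1r// => v /negbTE ->.
by rewrite expr0 expr1n.
Qed.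

Lemma hash_entry_norm (R : realType) (m n s : nat)
    (t : {ffun 'I_n -> s.-tuple 'I_m}) (b : {ffun 'I_n * 'I_s -> bool})
    (u : 'I_m * 'I_n) : uniq (t u.2) ->
  `|hash_entry R t b u| = (u.1 \in t u.2)%:R.
Proof.
move=> ut; have [/tnthP[k uk]|ut'] := boolP (u.1 \in t u.2).
  rewrite /hash_entry (big_pred1 k) ?normr_sign// => l /=.
  by rewrite uk (inj_eq (tuple_uniqP _ ut)).
rewrite /hash_entry big_pred0 ?normr0// => k.
by apply: contraNF ut' => /eqP <-; exact: mem_tnth.
Qed.

Lemma big_pair (R : Type) (idx : R) (op : Monoid.com_law idx) (I J : finType)
    (F : I * J -> R) :
  \big[op/idx]_u F u = \big[op/idx]_i \big[op/idx]_j F (i, j).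
Proof. by rewrite pair_bigA; apply: eq_bigr => -[]. Qed.

(** The [a]-th moment of a variable equal to 1 or -1 with probability q/2 each, and to 0
    otherwise. *)
Definition even_moment (R : realType) (q : R) (a : nat) : R :=
  if odd a then 0 else if a == 0%N then 1 else q.

(** Entries have absolute value 0 or 1, so a monomial is at most the indicator that each column [j]
    hits all its rows in [S j]. Columns are independent, and negative correlation bounds each
    column. *)
Lemma hash_monomial_even (R : realType) (m n s : nat) (a : 'I_m * 'I_n -> nat) :
  (s <= m)%N -> (0 < m)%N -> (forall u, ~~ odd (a u)) ->
  \sum_(t : {ffun 'I_n -> s.-tuple 'I_m}) \sum_(b : {ffun 'I_n * 'I_s -> bool})
    hash_weight R t b * \prod_u hash_entry R t b u ^+ a u <=
  \prod_u even_moment (s%:R / m%:R) (a u).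
Proof.
move=> sm m0 ev.
pose S j : {set 'I_m} := [set i | a (i, j) != 0%N]%SET.
apply: (@le_trans _ _ (\sum_(t : {ffun 'I_n -> s.-tuple 'I_m})
    \prod_j (tuple_weight R (t j) * [forall i in S j, i \in t j]%:R))); last first.
  rewrite (sum_prod_ffun (fun j t => tuple_weight R t * [forall i in S j, i \in t]%:R)).
  have -> : \prod_u even_moment (s%:R / m%:R) (a u) =
      \prod_j ((s%:R / m%:R) ^+ #|S j| : R).
    rewrite big_pair exchange_big/=; apply: eq_bigr => j _.
    rewrite -prodr_const [RHS]big_mkcond/=; apply: eq_bigr => i _.
    by rewrite /even_moment (negbTE (ev _)) inE; case: eqP.
  apply: ler_prod => j _; rewrite tuple_weight_contains// andbT.
  by apply: sumr_ge0 => t _; rewrite mulr_ge0// tuple_weight_ge0.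
apply: ler_sum => t _.
rewrite -[leRHS]mulr1 -[X in _ <= _ * X](sum_bool_half R ('I_n * 'I_s)%type).
rewrite mulr_sumr; apply: ler_sum => b _; rewrite big_split/= /hash_weight.
rewrite mulrAC ler_wpM2r//; first by apply: prodr_ge0 => u _; rewrite invr_ge0.
have [ut|] := boolP [forall j, uniq (t j)]; last first.
  by move=> /forallPn[j uj]; rewrite (bigD1 j)//= /tuple_weight (negbTE uj) !mul0r.
rewrite ler_wpM2l//; first by apply: prodr_ge0 => j _; exact: tuple_weight_ge0.
apply: le_trans (ler_norm _) _; rewrite normr_prod.
rewrite big_pair exchange_big/=; apply: ler_prod => j _; apply/andP; split; first exact: prodr_ge0.
have uj := forallP ut j.
have [_|/forall_inPn[i]] := boolP [forall i in S j, i \in t j].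
  apply: prodr_ile1 => i; rewrite normr_ge0 normrX hash_entry_norm//=.
  by case: (_ \in _); rewrite ?expr1n// expr0n; case: eqP.
rewrite inE => ai it; rewrite (bigD1 i)//= normrX hash_entry_norm//= (negbTE it).
by rewrite expr0n (negbTE ai) mul0r.
Qed.

(** Each symbol [z] of a word stands for the product of the two variables [al z] and [be z]; this is
    the exponent of the variable [u] in the whole word. *)
Definition letter_count (Z U : finType) (al be : Z -> U) (p : nat)
    (f : {ffun 'I_p -> Z}) (u : U) : nat :=
  \sum_(x < p) ((al (f x) == u) + (be (f x) == u)).

Lemma prod_word (R : realType) (Z U : finType) (al be : Z -> U) (c : U -> R)
    (p : nat) (f : {ffun 'I_p -> Z}) :
  \prod_(x < p) (c (al (f x)) * c (be (f x))) =
  \prod_u c u ^+ letter_count al be f u.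
Proof.
under [RHS]eq_bigr do rewrite -prodrXr.
rewrite exchange_big/=; apply: eq_bigr => x _.
under eq_bigr do rewrite exprD.
rewrite big_split/=; congr (_ * _).
  rewrite (bigD1 (al (f x)))//= eqxx expr1 big1 ?mulr1// => u ux.
  by rewrite eq_sym (negbTE ux) expr0.
rewrite (bigD1 (be (f x)))//= eqxx expr1 big1 ?mulr1// => u ux.
by rewrite eq_sym (negbTE ux) expr0.
Qed.

Lemma sum_letter_count (Z U : finType) (al be : Z -> U) (p : nat)
    (f : {ffun 'I_p -> Z}) : (\sum_u letter_count al be f u = p.*2)%N.
Proof.
rewrite exchange_big/= (eq_bigr (fun=> 2%N)).
  by rewrite sum_nat_const card_ord muln2.
move=> x _; rewrite big_split/= (bigD1 (al (f x)))//= eqxx big1 ?addn0.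
  rewrite (bigD1 (be (f x)))//= eqxx big1// => u ux.
  by rewrite eq_sym (negbTE ux).
by move=> u ux; rewrite eq_sym (negbTE ux).
Qed.

Lemma expr_word (R : realType) (Z U : finType) (al be : Z -> U) (c y : U -> R)
    (Q : pred Z) (p : nat) :
  (\sum_(z | Q z) (c (al z) * y (al z)) * (c (be z) * y (be z))) ^+ p =
  \sum_(f : {ffun 'I_p -> Z} | [forall x, Q (f x)])
    (\prod_u y u ^+ letter_count al be f u) *
    \prod_u c u ^+ letter_count al be f u.
Proof.
rewrite -[in LHS](card_ord p) -prodr_const.
under [LHS]eq_bigr do rewrite big_mkcond/=.
rewrite bigA_distr_bigA/= [RHS]big_mkcond/=; apply: eq_bigr => f _.
case: ifPn => [/forallP Qf|/forallPn[x Qx]]; last first.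
  by rewrite (bigD1 x)//= (negbTE Qx) mul0r.
under [LHS]eq_bigr do rewrite Qf.
rewrite (prod_word al be (fun u => c u * y u)) -big_split/=.
by apply: eq_bigr => u _; rewrite exprMn mulrC.
Qed.

(** [x.1] tells whether the entry is nonzero and [x.2] is its sign, drawn even when the entry is
    0. *)
Definition sign_weight (R : realType) (q : R) (x : bool * bool) : R :=
  (if x.1 then q else 1 - q) / 2.

Definition sign_value (R : realType) (x : bool * bool) : R :=
  x.1%:R * (-1) ^+ x.2.

Lemma sign_moment (R : realType) (q : R) (a : nat) :
  \sum_x sign_weight q x * sign_value R x ^+ a = even_moment q a.
Proof.
rewrite big_pair.
rewrite !big_bool/= /sign_weight /sign_value /even_moment/=.
rewrite !mul0r !mul1r expr1 expr0 expr1n expr0n -signr_odd.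
case: (eqVneq a 0%N) => [->/=|a0]; first by rewrite expr0; field.
by case: (odd a); rewrite /= ?expr1 ?expr0; field.
Qed.

(** The part of the squared row sum that fluctuates: over all rows of a hashing matrix, the diagonal
    terms add up to a constant. *)
Definition off_diag_form (R : realType) (n : nat) (y c : 'I_n -> R) : R :=
  \sum_(z : 'I_n * 'I_n | z.1 != z.2) (c z.1 * y z.1) * (c z.2 * y z.2).

Lemma sum_off_diag_expr (R : realType) (m n p : nat) (y : 'I_n -> R)
    (c : 'I_m * 'I_n -> R) :
  (\sum_i off_diag_form y (fun j => c (i, j))) ^+ p =
  \sum_(f : {ffun 'I_p -> 'I_m * ('I_n * 'I_n)} |
      [forall x, (f x).2.1 != (f x).2.2])
    let a := letter_count (fun z => (z.1, z.2.1)) (fun z => (z.1, z.2.2)) f in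
    (\prod_u y u.2 ^+ a u) * \prod_u c u ^+ a u.
Proof.
rewrite /= -(expr_word (fun z : 'I_m * ('I_n * 'I_n) => (z.1, z.2.1))
  (fun z => (z.1, z.2.2)) c (fun u => y u.2) (fun z => z.2.1 != z.2.2)) /=.
congr (_ ^+ _).
by rewrite (pair_big predT (fun z : 'I_n * 'I_n => z.1 != z.2)
  (fun i z => (c (i, z.1) * y z.1) * (c (i, z.2) * y z.2))).
Qed.

(* Monomials with an odd exponent have mean 0 on both sides, the other ones have
   nonnegative coefficients and a larger mean under independent entries. *)
Lemma hash_moment_le_iid (R : realType) (m n s p : nat) (y : 'I_n -> R) :
  (s <= m)%N -> (0 < m)%N ->
  \sum_(t : {ffun 'I_n -> s.-tuple 'I_m}) \sum_(b : {ffun 'I_n * 'I_s -> bool})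
    hash_weight R t b *
    (\sum_i off_diag_form y (fun j => hash_entry R t b (i, j))) ^+ p <=
  \sum_(c : {ffun 'I_m -> {ffun 'I_n -> bool * bool}})
    (\prod_i \prod_j sign_weight (s%:R / m%:R) (c i j)) *
    (\sum_i off_diag_form y (fun j => sign_value R (c i j))) ^+ p.
Proof.
move=> sm m0; set q : R := s%:R / m%:R.
pose a := @letter_count ('I_m * ('I_n * 'I_n))%type ('I_m * 'I_n)%type
  (fun z => (z.1, z.2.1)) (fun z => (z.1, z.2.2)) p.
have -> : \sum_(c : {ffun 'I_m -> {ffun 'I_n -> bool * bool}})
    (\prod_i \prod_j sign_weight q (c i j)) *
    (\sum_i off_diag_form y (fun j => sign_value R (c i j))) ^+ p =
  \sum_(f : {ffun 'I_p -> 'I_m * ('I_n * 'I_n)} |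
      [forall x, (f x).2.1 != (f x).2.2])
    (\prod_u y u.2 ^+ a f u) * \prod_u even_moment q (a f u).
  under eq_bigr => c _.
    rewrite (sum_off_diag_expr p y (fun u => sign_value R (c u.1 u.2))) mulr_sumr.
    over.
  rewrite exchange_big/=; apply: eq_bigr => f _.
  under eq_bigr do rewrite mulrCA.
  rewrite -mulr_sumr -/(a f); congr (_ * _).
  rewrite [in RHS]big_pair.
  under [RHS]eq_bigr do under eq_bigr do rewrite -sign_moment.
  under [RHS]eq_bigr => i _ do
    rewrite -(sum_prod_ffun (fun j x => sign_weight q x * sign_value R x ^+ a f (i, j))).
  rewrite -(sum_prod_ffun (fun i (r : {ffun 'I_n -> bool * bool}) =>
    \prod_j (sign_weight q (r j) * sign_value R (r j) ^+ a f (i, j)))).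
  apply: eq_bigr => c _.
  rewrite big_pair -big_split/=.
  by apply: eq_bigr => i _; rewrite -big_split.
under eq_bigr => t _.
  under eq_bigr => b _.
    rewrite (sum_off_diag_expr p y (hash_entry R t b)) mulr_sumr.
    over.
  rewrite exchange_big/=.
  over.
rewrite exchange_big/=; apply: ler_sum => f _.
under eq_bigr => t _ do under eq_bigr do rewrite mulrCA.
under eq_bigr do rewrite -mulr_sumr.
rewrite -mulr_sumr -/(a f).
have [/forallP ev|/forallPn[u]] := boolP [forall u, ~~ odd (a f u)].
  rewrite ler_wpM2l// ?hash_monomial_even//.
  by apply: prodr_ge0 => u _; rewrite exprn_even_ge0.
rewrite negbK => ou; rewrite [X in _ * X]big1 ?mulr0; last first.
  move=> t _; rewrite -mulr_sumr (hash_monomial_odd _ _ ou) mulr0//.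
by rewrite [X in _ * X](bigD1 u)//= /even_moment ou mul0r mulr0.
Qed.

(** * Moments of one row *)

(** The elementary symmetric polynomial is the coefficient of t^l in the product of the 1 + t a_j,
    itself at most exp(t sum a_j); take t = l. *)
Lemma sum_esym_le (R : realType) (n l : nat) (a : 'I_n -> R) :
  (forall j, 0 <= a j) -> \sum_j a j <= 1 -> (0 < l)%N ->
  \sum_(J : {set 'I_n} | #|J| == l) \prod_(j in J) a j <= expR l%:R / l%:R ^+ l.
Proof.
move=> a0 a1 l0; have lR : 0 < l%:R :> R by rewrite ltr0n.
rewrite ler_pdivlMr ?exprn_gt0//.
apply: (@le_trans _ _ (\prod_j (l%:R * a j + 1))); last first.
  apply: (@le_trans _ _ (expR (\sum_j l%:R * a j))).
    rewrite expR_sum; apply: ler_prod => j _.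
    by rewrite addr_ge0 ?mulr_ge0//= addrC expR_ge1Dx.
  by rewrite ler_expR -mulr_sumr -[leRHS]mulr1 ler_wpM2l.
rewrite bigA_distr/= mulr_suml big_mkcond/=; apply: ler_sum => J _.
rewrite -big_mkcond/= big_split/= prodr_const; case: eqP => [->|_].
  by rewrite mulrC.
by apply: mulr_ge0; [exact: exprn_ge0|apply: prodr_ge0].
Qed.

Lemma row_momentE (R : realType) (n k : nat) (q : R) (y : 'I_n -> R) :
  \sum_(r : {ffun 'I_n -> bool * bool}) (\prod_j sign_weight q (r j)) *
    off_diag_form y (fun j => sign_value R (r j)) ^+ k =
  \sum_(f : {ffun 'I_k -> 'I_n * 'I_n} | [forall x, (f x).1 != (f x).2])
    let a := letter_count fst snd f in
    (\prod_j y j ^+ a j) * \prod_j even_moment q (a j).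
Proof.
under eq_bigr => r _ do rewrite /off_diag_form
  (expr_word fst snd (fun j => sign_value R (r j)) y (fun z => z.1 != z.2)) mulr_sumr.
rewrite exchange_big/=; apply: eq_bigr => f _.
under eq_bigr do rewrite mulrCA.
rewrite -mulr_sumr; congr (_ * _).
under [RHS]eq_bigr do rewrite -sign_moment.
rewrite -(sum_prod_ffun (fun j x => sign_weight q x *
  sign_value R x ^+ letter_count fst snd f j)).
by apply: eq_bigr => r _; rewrite -big_split.
Qed.

(** This holds for odd [k] too: a word survives only if every letter has an even exponent, and then
    the powers of [y] are even. It is what lets a coefficient be bounded by a value of the
    generating polynomial. *)
Lemma row_moment_ge0 (R : realType) (n k : nat) (q : R) (y : 'I_n -> R) :
  0 <= q ->
  0 <= \sum_(r : {ffun 'I_n -> bool * bool}) (\prod_j sign_weight q (r j)) *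
    off_diag_form y (fun j => sign_value R (r j)) ^+ k.
Proof.
move=> q0; rewrite row_momentE/=; apply: sumr_ge0 => f _.
rewrite -big_split/=; apply: prodr_ge0 => j _; rewrite /even_moment.
have [|o] := boolP (odd _); first by rewrite mulr0.
by rewrite mulr_ge0 ?exprn_even_ge0//; case: ifP.
Qed.

(** Each letter used keeps y_j^2, to be summed later against the unit norm; the exponents in excess
    of 2 total 2(k - #|J|) and are paid by nu. *)
Lemma word_weight_le (R : realType) (n k : nat) (q nu : R) (y : 'I_n -> R)
    (a : 'I_n -> nat) (J : {set 'I_n}) :
  0 <= q -> (forall j, `|y j| <= nu) -> (\sum_j a j = k.*2)%N ->
  (forall j, ~~ odd (a j)) -> J = [set j | a j != 0%N]%SET ->
  (#|J| <= k)%N /\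
  (\prod_j y j ^+ a j) * \prod_j even_moment q (a j) <=
  q ^+ #|J| * nu ^+ (k - #|J|).*2 * \prod_(j in J) y j ^+ 2.
Proof.
move=> q0 ynu ak ev JE.
have a2 j : j \in J -> (2 <= a j)%N.
  by rewrite JE inE; move: (ev j); case: (a j) => [|[|]].
have aJ : (\sum_(j in J) (a j - 2) + #|J|.*2 = k.*2)%N.
  rewrite -ak [RHS](bigID [in J])/= [X in (_ = _ + X)%N]big1 ?addn0; last first.
    by move=> j; rewrite JE inE negbK => /eqP.
  rewrite -muln2 -sum_nat_const -big_split/=; apply: eq_bigr => j jJ.
  by rewrite subnK// a2.
have Jk : (#|J| <= k)%N by rewrite -leq_double -aJ leq_addl.
split=> //.
have -> : ((k - #|J|).*2 = \sum_(j in J) (a j - 2))%N.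
  by rewrite doubleB -aJ addnK.
rewrite -prodrXr -(prodr_const [in J] q) -!big_split/= [leRHS]big_mkcond/=.
apply: ler_prod => j _; rewrite /even_moment (negbTE (ev j)).
rewrite mulr_ge0 ?exprn_even_ge0//=; last by case: ifP.
have [jJ|] := boolP (j \in J).
  have := a2 j jJ; case: (a j) => [|[|c]]//= _.
  rewrite (_ : (c.+2 - 2 = c)%N); last by lia.
  rewrite [leLHS]mulrC -[leRHS]mulrA ler_wpM2l// !exprSr -mulrA expr0 mul1r -expr2.
  rewrite ler_wpM2r ?sqr_ge0//.
  by apply: le_trans (ler_norm _) _; rewrite normrX lerXn2r ?nnegrE//; exact: le_trans (ynu j).
by rewrite JE inE negbK => /eqP ->; rewrite eqxx expr0 mulr1.
Qed.

(* Words are grouped by their set J of letters: at most (#|J| ^ 2) ^ k words use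
   the letters of J only, and 2 <= #|J| <= k since each letter occurs an even
   number of times and no pair is diagonal. *)
Lemma row_moment_le (R : realType) (n k : nat) (q nu : R) (y : 'I_n -> R) :
  0 <= q -> (forall j, `|y j| <= nu) -> \sum_j y j ^+ 2 <= 1 -> (0 < k)%N ->
  \sum_(r : {ffun 'I_n -> bool * bool}) (\prod_j sign_weight q (r j)) *
    off_diag_form y (fun j => sign_value R (r j)) ^+ k <=
  \sum_(l < k.+1 | (2 <= l)%N)
    q ^+ l * nu ^+ (k - l).*2 * l%:R ^+ k.*2 * (expR l%:R / l%:R ^+ l).
Proof.
move=> q0 ynu y1 k0; rewrite row_momentE.
(* Without coordinates nothing forces [nu] to be nonnegative; the bound still holds because [nu]
   occurs with even exponents. *)
have [n0|n0] := posnP n.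
  rewrite big_pred0; last first.
    move=> f; apply/negP => _; by have := leq_trans (ltn_ord (f (Ordinal k0)).1) (eq_leq n0).
  apply: sumr_ge0 => l _; apply: mulr_ge0; last by rewrite divr_ge0 ?expR_ge0.
  by rewrite mulr_ge0// mulr_ge0 ?(exprn_ge0 _ q0)// exprn_even_ge0// odd_double.
have nu0 : 0 <= nu by apply: le_trans (ynu (Ordinal n0)).
pose J (f : {ffun 'I_k -> 'I_n * 'I_n}) : {set 'I_n} :=
  [set j | letter_count fst snd f j != 0%N]%SET.
pose G (J : {set 'I_n}) : R :=
  q ^+ #|J| * nu ^+ (k - #|J|).*2 * \prod_(j in J) y j ^+ 2.
have G0 K : 0 <= G K.
  by rewrite !mulr_ge0 ?exprn_ge0//; apply: prodr_ge0 => j _; exact: sqr_ge0.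
have inJ (f : {ffun 'I_k -> 'I_n * 'I_n}) x : ((f x).1 \in J f) && ((f x).2 \in J f).
  by rewrite !inE /letter_count; apply/andP; split; rewrite (bigD1 x)//= eqxx
    ?addn1 ?add1n addSn.
apply: (@le_trans _ _ (\sum_(f : {ffun 'I_k -> 'I_n * 'I_n} |
    (2 <= #|J f| <= k)%N) G (J f))).
  rewrite big_mkcond [leRHS]big_mkcond/=; apply: ler_sum => f _.
  case: ifPn => [/forallP fne|_]; last by case: ifP.
  have [/forallP ev|/forallPn[j]] := boolP [forall j, ~~ odd (letter_count fst snd f j)].
    have [Jk le] := word_weight_le q0 ynu (sum_letter_count fst snd f) ev (erefl (J f)).
    rewrite Jk andbT ifT//.
    have x := Ordinal k0; have /andP[x1 x2] := inJ f x.
    by apply/card_gt1P; exists (f x).1, (f x).2.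
  rewrite negbK => oj; rewrite [X in _ * X](bigD1 j)//= /even_moment oj mul0r mulr0.
  by case: ifP.
rewrite (partition_big J (fun K => (2 <= #|K| <= k)%N))//=.
apply: (@le_trans _ _ (\sum_(K : {set 'I_n} | (2 <= #|K| <= k)%N)
    #|K|%:R ^+ k.*2 * G K)).
  apply: ler_sum => K _.
  under eq_bigr => f /andP[_ /eqP ->] do [].
  rewrite sumr_const -[leLHS]mulr_natl ler_wpM2r// -natrX ler_nat.
  rewrite -muln2 mulnC expnM -mulnn.
  have -> : ((#|K| * #|K|) ^ k = #|ffun_on [in [predX K & K]] : {pred {ffun 'I_k -> _}}|)%N.
    by rewrite card_ffun_on card_ord; congr (_ ^ _)%N; exact/esym/cardX.
  apply: subset_leq_card; apply/fintype.subsetP => f /andP[_ /eqP <-].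
  by apply/ffun_onP => x; rewrite inE inJ.
rewrite (partition_big (fun K : {set 'I_n} => inord #|K| : 'I_k.+1)
  (fun l : 'I_k.+1 => (2 <= l)%N))/=; last first.
  by move=> K /andP[? ?]; rewrite inordK.
apply: ler_sum => l l2.
apply: (@le_trans _ _ (\sum_(K : {set 'I_n} | #|K| == l)
   (q ^+ l * nu ^+ (k - l).*2 * l%:R ^+ k.*2) * \prod_(j in K) y j ^+ 2)).
  rewrite big_mkcond [leRHS]big_mkcond/=; apply: ler_sum => K _.
  case: ifPn => [/andP[/andP[K2 Kk]]|_].
    rewrite -val_eqE/= inordK// => Kl; rewrite Kl (eqP Kl) /G (eqP Kl).
    by rewrite mulrA [X in X * _]mulrC.
  case: ifP => // _; rewrite !mulr_ge0 ?exprn_ge0//.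
  by apply: prodr_ge0 => j _; exact: sqr_ge0.
rewrite -mulr_sumr ler_wpM2l// ?mulr_ge0 ?exprn_ge0//.
by apply: sum_esym_le => //; [move=> j; exact: sqr_ge0|apply: leq_trans l2].
Qed.

(** * Tail bound for one flat vector *)

(** The generating polynomial of one row is 1, the total mass at k = 0, plus the higher moments x;
    then (1 + x)^m <= exp(m x). *)
Lemma hash_moment_le (R : realType) (m n s p : nat) (nu lam : R) (y : 'I_n -> R) :
  (s <= m)%N -> (0 < m)%N -> 0 < lam ->
  (forall j, `|y j| <= nu) -> \sum_j y j ^+ 2 <= 1 ->
  \sum_(t : {ffun 'I_n -> s.-tuple 'I_m}) \sum_(b : {ffun 'I_n * 'I_s -> bool})
    hash_weight R t b *
    (\sum_i off_diag_form y (fun j => hash_entry R t b (i, j))) ^+ p <=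
  p`!%:R / lam ^+ p * expR (m%:R * \sum_(k < p.+1) \sum_(l < k.+1 | (2 <= l)%N)
    lam ^+ k * ((s%:R / m%:R) ^+ l * nu ^+ (k - l).*2 * l%:R ^+ k.*2 *
      (expR l%:R / l%:R ^+ l)) / k`!%:R).
Proof.
move=> sm m0 lam0 ynu y1; apply: le_trans (hash_moment_le_iid p y sm m0) _.
set q : R := s%:R / m%:R; have q0 : 0 <= q by rewrite divr_ge0.
apply: le_trans (moment_iid_sum_le m p lam0 (fun k => row_moment_ge0 k y q0)) _.
rewrite ler_wpM2l//; first by rewrite divr_ge0// exprn_ge0// ltW.
rewrite expRM_natl lerXn2r ?nnegrE ?expR_ge0//.
  apply: sumr_ge0 => k _; rewrite divr_ge0// mulr_ge0//.
    by rewrite exprn_ge0// ltW.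
  exact: row_moment_ge0.
apply: le_trans _ (expR_ge1Dx _).
rewrite big_ord_recl [in leRHS]big_ord_recl/= [X in 1 + (X + _)]big1 ?add0r; last first.
  by move=> [[|l] /= l0].
rewrite expr0 mul1r fact0 divr1; apply: lerD.
  under eq_bigr do rewrite expr0 mulr1.
  rewrite (sum_prod_ffun (fun _ x => sign_weight q x)) big1// => j _.
  rewrite (eq_bigr (fun x => sign_weight q x * sign_value R x ^+ 0)) ?sign_moment//.
  by move=> x _; rewrite expr0 mulr1.
apply: ler_sum => k _; rewrite -mulr_suml -mulr_sumr ler_pM2r ?invr_gt0 ?ltr0n ?fact_gt0//.
by rewrite ler_pM2l ?exprn_gt0// row_moment_le.
Qed.

(** With k = l + h, the powers of l combine to l^l l^(2h). The bounds l^l <= l! e^l and l! h! <= k!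
    then trade 1/k! for 1/h!, leaving the terms of an exponential series in h. *)
Lemma moment_term_le (R : realType) (q lam nu : R) (k l : nat) :
  0 <= q -> 0 < lam -> (2 <= l <= k)%N ->
  lam ^+ k * (q ^+ l * nu ^+ (k - l).*2 * l%:R ^+ k.*2 *
      (expR l%:R / l%:R ^+ l)) / k`!%:R <=
  (q * lam * expR 2) ^+ l * ((lam * nu ^+ 2 * l%:R ^+ 2) ^+ (k - l) / (k - l)`!%:R).
Proof.
move=> q0 lam0 /andP[l2 lk].
have f0 n : 0 < n`!%:R :> R by rewrite ltr0n fact_gt0.
have l0 : 0 < l%:R :> R by rewrite ltr0n; lia.
pose h := (k - l)%N; have kE : k = (l + h)%N by rewrite /h; lia.
rewrite -/h kE {lk}.
have -> : (q * lam * expR 2) ^+ l = q ^+ l * lam ^+ l * (expR l%:R * expR l%:R).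
  by rewrite !exprMn -expRM_natr -expRD; congr (_ * expR _); ring.
rewrite -(mul2n h) (exprM nu) -addnn !exprD !exprMn.
set ql := q ^+ l; set Ll := lam ^+ l; set Lh := lam ^+ h; set N2 := nu ^+ h * nu ^+ h.
have N20 : 0 <= N2 by rewrite /N2 -expr2 sqr_ge0.
clearbody N2.
set el := expR l%:R; set A := l%:R ^+ l; set B := l%:R ^+ h.
have A0 : 0 < A by rewrite exprn_gt0.
have Af : A <= l`!%:R * el by apply: exprn_fact_le; exact: ltW.
have lhf : l`!%:R * h`!%:R <= (l + h)`!%:R :> R.
  rewrite -natrM ler_nat -(@bin_fact (l + h) l) ?leq_addr// addKn.
  by rewrite leq_pmull// bin_gt0 leq_addr.
rewrite ler_pdivrMr//.
have -> : Ll * Lh * (ql * N2 * (A * B * (A * B)) * (el / A)) =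
  (ql * Ll * Lh * N2 * B * B * el) * A by field; exact: lt0r_neq0.
have -> : ql * Ll * (el * el) * (Lh * N2 * (B * B) / h`!%:R) * (l + h)`!%:R =
  (ql * Ll * Lh * N2 * B * B * el) * (el * ((l + h)`!%:R / h`!%:R)).
  by field; exact: lt0r_neq0.
rewrite ler_wpM2l//.
  by rewrite !mulr_ge0 ?exprn_ge0 ?expR_ge0 ?(ltW lam0) ?(ltW l0)//.
apply: le_trans Af _; rewrite mulrC ler_wpM2l ?expR_ge0//.
by rewrite ler_pdivlMr.
Qed.

Lemma fact_le_expn (h p : nat) : (h <= p)%N -> (h`! <= p ^ h)%N.
Proof.
move=> hp; apply: leq_trans (fact_le_exp h) _.
by case: h hp => // h hp; rewrite leq_exp2r.
Qed.

(** As h <= p, h! <= p^h, so x^h / h! <= (b^h / h!)^2. The truncated series thus grows like exp(2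
    sqrt(x p)), which beats exp x when x is large compared with p; for x proportional to l^2 the
    exponent becomes linear in l. *)
Lemma sum_expR_sqr_le (R : realType) (x b : R) (p N : nat) :
  0 <= b -> 0 <= x -> x * p%:R <= b ^+ 2 -> (0 < p)%N -> (N <= p.+1)%N ->
  \sum_(h < N) x ^+ h / h`!%:R <= expR (2 * b).
Proof.
move=> b0 x0 xb p0 Np.
have f0 n : 0 < n`!%:R :> R by rewrite ltr0n fact_gt0.
rewrite (_ : 2 * b = b + b); last by ring.
rewrite expRD; apply: le_trans (ler_wpM2r (expR_ge0 b) (sum_expR_le N b0)).
rewrite mulr_suml; apply: ler_sum => h _.
apply: (@le_trans _ _ (b ^+ h / h`!%:R * (b ^+ h / h`!%:R))); last first.
  rewrite ler_wpM2l ?divr_ge0 ?exprn_ge0//.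
  by rewrite ler_pdivrMr// mulrC exprn_fact_le.
rewrite mulrACA -invfM -expr2 -exprM mulnC exprM.
rewrite ler_pdivlMr ?mulr_gt0// mulrA mulfVK ?lt0r_neq0//.
apply: (@le_trans _ _ (x ^+ h * p%:R ^+ h)).
  rewrite ler_wpM2l ?exprn_ge0// -natrX ler_nat fact_le_expn//.
  by have := ltn_ord h; lia.
by rewrite -exprMn lerXn2r ?nnegrE ?mulr_ge0// exprn_ge0.
Qed.

Lemma sum_triangle (R : realType) (P : pred nat) (T : nat -> nat -> R) (p : nat) :
  \sum_(k < p.+1) \sum_(l < k.+1 | P l) T k l =
  \sum_(l < p.+1 | P l) \sum_(h < (p - l).+1) T (l + h)%N l.
Proof.
elim: p => [|p IH].
  rewrite big_ord_recl big_ord0 addr0 big_mkcond [RHS]big_mkcond.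
  by rewrite !big_ord_recl !big_ord0/= addn0 !addr0.
rewrite big_ord_recr/= IH [in RHS]big_mkcond [in RHS]big_ord_recr/= -[in RHS]big_mkcond/=.
rewrite [X in _ + X = _]big_mkcond [X in _ + X = _]big_ord_recr/=.
rewrite -[X in _ + (X + _) = _]big_mkcond/= addrA; congr (_ + _).
  rewrite -big_split/=; apply: eq_bigr => l _.
  rewrite subSn -1?ltnS// [RHS]big_ord_recr/=; congr (_ + T _ _).
  by have := ltn_ord l; lia.
by rewrite subnn big_ord_recl big_ord0 addn0 addr0.
Qed.

(* Here X = E / (C2 * eps). The term l = 2 needs the bound on lam * nu ^ 2 by
   ln E, all the others the bound by (ln X) ^ 2 / p. *)
Lemma moment_sum_le (R : realType) (q lam nu b E C2 eps G L : R) (m p : nat) :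
  (0 < p)%N -> (0 < m)%N -> 0 <= q -> 0 < lam -> 0 <= b -> 1 <= E -> 0 < C2 ->
  0 < eps -> 0 < L -> 0 < G -> C2 * eps <= 1 -> G * C2 <= 2^-1 ->
  E * L <= m%:R * C2 ^+ 2 * eps ^+ 2 -> q * lam * expR 2 * eps * m%:R <= G * L ->
  4 * (lam * nu ^+ 2) <= ln E -> lam * nu ^+ 2 * p%:R <= b ^+ 2 ->
  6 * b <= ln (E / (C2 * eps)) ->
  m%:R * \sum_(k < p.+1) \sum_(l < k.+1 | (2 <= l)%N)
    lam ^+ k * (q ^+ l * nu ^+ (k - l).*2 * l%:R ^+ k.*2 *
      (expR l%:R / l%:R ^+ l)) / k`!%:R <= L.
Proof.
move=> p0 m0 q0 lam0 b0 E1 C20 eps0 L0 G0 Ce GC mE qG bE bp bX.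
have E0 : 0 < E by lra.
have mR : 0 < m%:R :> R by rewrite ltr0n.
have Ce0 : 0 < C2 * eps by rewrite mulr_gt0.
set X := E / (C2 * eps) in bX *.
have X0 : 0 < X by rewrite divr_gt0.
have X1 : 1 <= X by rewrite ler_pdivlMr//; lra.
set be := lam * nu ^+ 2 in bE bp *.
have be0 : 0 <= be by rewrite mulr_ge0 ?sqr_ge0 ?ltW.
set g := q * lam * expR 2 in qG *.
have g0 : 0 <= g by rewrite mulr_ge0 ?expR_ge0// mulr_ge0// ltW.
(* It suffices that the words on l columns contribute at most L / 2^l. *)
apply: (@le_trans _ _ (\sum_(l < p.+1 | (2 <= l)%N) L * 2^-1 ^+ l)); last first.
  rewrite -mulr_sumr -[leRHS]mulr1 ler_pM2l//.
  have -> : \sum_(l < p.+1 | (2 <= l)%N) 2^-1 ^+ l = 2^-1 - (2^-1 : R) ^+ p.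
    elim: p p0 {bp} => // -[|p] IH _; first by rewrite big1 ?expr1 ?subrr// => -[[|[]]].
    rewrite big_mkcond big_ord_recr/= -big_mkcond/= IH// [in RHS]exprS.
    set z := 2^-1 ^+ p.+1; rewrite exprS -/z; lra.
  have : 0 <= (2^-1 : R) ^+ p by rewrite exprn_ge0// invr_ge0.
  lra.
apply: (@le_trans _ _ (m%:R * \sum_(l < p.+1 | (2 <= l)%N) \sum_(h < (p - l).+1)
    g ^+ l * ((be * l%:R ^+ 2) ^+ h / h`!%:R))).
  rewrite ler_pM2l//.
  pose T k l : R := g ^+ l * ((be * l%:R ^+ 2) ^+ (k - l) / (k - l)`!%:R).
  apply: (@le_trans _ _ (\sum_(k < p.+1) \sum_(l < k.+1 | (2 <= l)%N) T k l)).
    apply: ler_sum => k _; apply: ler_sum => l l2.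
    by apply: moment_term_le => //; rewrite l2 -ltnS ltn_ord.
  rewrite (sum_triangle (leq 2)) le_eqVlt; apply/orP; left; apply/eqP.
  by apply: eq_bigr => l _; apply: eq_bigr => h _; rewrite /T addKn.
rewrite mulr_sumr; apply: ler_sum => l l2.
rewrite -mulr_sumr.
set S := \sum_(h < _) _.
(* For l >= 3 the series is at most exp(2 b l) <= X^(l/3), by 6 b <= ln X, and l/3 <= l - 2. *)
have SX : S <= E * X ^+ (l - 2).
  have [l3|l3] := ltnP 2 l; last first.
    have l2E : l = 2%N :> nat by apply/eqP; rewrite eqn_leq l3.
    rewrite l2E subnn expr0 mulr1.
    apply: (@le_trans _ _ (expR (4 * be))); last by rewrite -ler_ln ?posrE ?expR_gt0// expRK.
    apply: le_trans (sum_expR_le _ _) _; first by rewrite mulr_ge0 ?sqr_ge0.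
    by rewrite ler_expR l2E -natrX mulrC.
  apply: (@le_trans _ _ (X ^+ (l - 2))); last by rewrite ler_peMl ?exprn_ge0 ?(ltW X0).
  apply: (@le_trans _ _ (expR (2 * (b * l%:R)))).
    apply: (@sum_expR_sqr_le _ _ _ p) => //; first by rewrite mulr_ge0.
    - by rewrite mulr_ge0 ?sqr_ge0.
    - by rewrite mulrAC exprMn ler_wpM2r ?sqr_ge0.
    - by rewrite ltnS leq_subr.
  rewrite -[leRHS]lnK ?posrE ?exprn_gt0// ler_expR.
  rewrite lnXn// -[leRHS]mulr_natl natrB//.
  have l3R : 3 <= l%:R :> R by rewrite ler_nat.
  have lnX : 0 <= ln X by rewrite ln_ge0.
  apply: (@le_trans _ _ (ln X / 3 * l%:R)); first by rewrite mulrA ler_wpM2r//; lra.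
  rewrite -subr_ge0 (_ : _ - _ = ln X * (2 / 3 * (l%:R - 3))); last by field.
  by rewrite mulr_ge0// mulr_ge0// subr_ge0.
(* Regroup as m g (g E) (g X)^(l-2), with m g (g E) <= L/4 and g X <= 1/2. *)
have gl : m%:R * g ^+ l * (E * X ^+ (l - 2)) <= L * 2^-1 ^+ l.
  have gE : g * E <= G * C2 * (C2 * eps).
    rewrite -(ler_pM2r L0); apply: (@le_trans _ _ (g * (m%:R * C2 ^+ 2 * eps ^+ 2))).
      by rewrite -(mulrA g) ler_wpM2l.
    rewrite (_ : g * _ = g * eps * m%:R * (C2 * (C2 * eps))); last by ring.
    apply: le_trans (ler_wpM2r _ qG) _; first by rewrite !mulr_ge0// ltW.
    by rewrite le_eqVlt; apply/orP; left; apply/eqP; ring.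
  have gX : g * X <= 2^-1.
    by rewrite /X mulrA ler_pdivrMr//; apply: le_trans gE _; rewrite ler_pM2r.
  have mgE : m%:R * g * (g * E) <= L * 2^-1 ^+ 2.
    apply: (@le_trans _ _ (m%:R * g * (G * C2 * (C2 * eps)))).
      by rewrite ler_wpM2l// mulr_ge0.
    rewrite (_ : m%:R * g * _ = g * eps * m%:R * (C2 * (G * C2))); last by ring.
    apply: le_trans (ler_wpM2r _ qG) _; first by rewrite !mulr_ge0// ltW.
    rewrite (_ : G * L * _ = L * ((G * C2) * (G * C2))); last by ring.
    by rewrite ler_pM2l// expr2 ler_pM// mulr_ge0// ltW.
  have spl (z : R) : z ^+ l = z ^+ (l - 2) * z ^+ 2 by rewrite -exprD subnK.
  rewrite (spl g) (spl 2^-1).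
  rewrite (_ : m%:R * _ * (E * _) = (m%:R * g * (g * E)) * (g * X) ^+ (l - 2)); last first.
    rewrite (exprMn _ g X); move: (g ^+ (l - 2)) (X ^+ (l - 2)) => g' X'; ring.
  rewrite (mulrC (2^-1 ^+ (l - 2))) [leRHS]mulrA; apply: ler_pM => //.
  - by rewrite !mulr_ge0// ltW.
  - by rewrite exprn_ge0// mulr_ge0// ltW.
  - by rewrite lerXn2r ?nnegrE// ?mulr_ge0 ?invr_ge0// ltW.
by rewrite mulrA; apply: le_trans gl; rewrite ler_wpM2l// mulr_ge0 ?exprn_ge0.
Qed.

(** Markov's inequality for the p-th power. The threshold times [lam] is e^3 p, so the bound is p!
    e^L / (e^3 p)^p <= e^(L - 3p) <= e^(-2L). The [eps / 5] anticipates the factor 5 lost in passing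
    from the net to all vectors. *)
Lemma hash_tail (R : realType) (m n s p : nat) (y : 'I_n -> R)
    (nu b E C2 eps L : R) :
  let lam := expR 3 * p%:R / (eps / 5 * s%:R) in
  (0 < s)%N -> (s <= m)%N -> (0 < p)%N -> ~~ odd p -> 0 <= b -> 1 <= E ->
  0 < C2 -> 0 < eps -> 0 < L -> C2 * eps <= 1 -> 10 * expR 5 * C2 <= 2^-1 ->
  E * L <= m%:R * C2 ^+ 2 * eps ^+ 2 -> L <= p%:R <= 2 * L ->
  4 * (lam * nu ^+ 2) <= ln E -> lam * nu ^+ 2 * p%:R <= b ^+ 2 ->
  6 * b <= ln (E / (C2 * eps)) ->
  (forall j, `|y j| <= nu) -> \sum_j y j ^+ 2 <= 1 ->
  \sum_(t : {ffun 'I_n -> s.-tuple 'I_m}) \sum_(b : {ffun 'I_n * 'I_s -> bool})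
    hash_weight R t b *
    (eps / 5 * s%:R < `|\sum_i off_diag_form y (fun j => hash_entry R t b (i, j))|)%R%:R
  <= expR (- (2 * L)).
Proof.
move=> lam s0 sm p0 ep b0 E1 C20 eps0 L0 Ce GC mE /andP[Lp pL] bE bp bX ynu y1.
have m0 : (0 < m)%N by apply: leq_trans sm.
have sR : 0 < s%:R :> R by rewrite ltr0n.
have mR : 0 < m%:R :> R by rewrite ltr0n.
have pR : 0 < p%:R :> R by rewrite ltr0n.
set D := eps / 5 * s%:R; have D0 : 0 < D by rewrite mulr_gt0// divr_gt0.
have lam0 : 0 < lam by rewrite divr_gt0// mulr_gt0// expR_gt0.
apply: (@le_trans _ _ (D ^- p * \sum_(t : {ffun 'I_n -> s.-tuple 'I_m})
    \sum_(b : {ffun 'I_n * 'I_s -> bool}) hash_weight R t b *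
    (\sum_i off_diag_form y (fun j => hash_entry R t b (i, j))) ^+ p)).
  rewrite mulr_sumr; apply: ler_sum => t _; rewrite mulr_sumr; apply: ler_sum => c _.
  rewrite mulrCA ler_wpM2l ?hash_weight_ge0//.
  set Q := \sum_i _; case: ltP => [DQ|_]; last first.
    apply: mulr_ge0; last exact: exprn_even_ge0.
    by rewrite invr_ge0 exprn_ge0// ltW.
  rewrite mulrC ler_pdivlMr ?exprn_gt0// mul1r.
  have -> : Q ^+ p = `|Q| ^+ p by rewrite -normrX ger0_norm// exprn_even_ge0.
  by rewrite lerXn2r ?nnegrE// ltW.
rewrite mulrC ler_pdivrMr ?exprn_gt0//.
apply: le_trans (hash_moment_le p sm m0 lam0 ynu y1) _.
have SL := @moment_sum_le R (s%:R / m%:R) lam nu b E C2 eps (10 * expR 5) L m p.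
apply: (@le_trans _ _ (p`!%:R / lam ^+ p * expR L)).
  rewrite ler_wpM2l//; first by rewrite divr_ge0// exprn_ge0// ltW.
  rewrite ler_expR; apply: SL => //.
  rewrite /lam [leLHS](_ : _ = 5 * (expR 3 * expR 2) * p%:R); last first.
      by field; rewrite !lt0r_neq0.
  rewrite -expRD (_ : 3 + 2 = 5 :> R); last by ring.
  rewrite (_ : 10 * expR 5 * L = 5 * expR 5 * (2 * L)); last by ring.
  by rewrite ler_wpM2l// mulr_ge0// expR_ge0.
rewrite mulrAC ler_pdivrMr ?exprn_gt0// -mulrA -exprMn.
rewrite (_ : D * lam = expR 3 * p%:R); last by rewrite /lam -/D mulrC divfK ?lt0r_neq0.
rewrite exprMn -expRM_natr mulrA -expRD mulrC.
apply: ler_pM; rewrite ?expR_ge0//.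
  by rewrite ler_expR; lra.
by rewrite -natrX ler_nat fact_le_exp.
Qed.

(** * An integer net for quadratic forms *)

Definition quad_form (R : realType) (r : nat) (M : 'M[R]_r) (v : 'cV[R]_r) : R :=
  (v^T *m M *m v) 0 0.

Lemma quad_formZ (R : realType) (r : nat) (M : 'M[R]_r) (c : R) (v : 'cV[R]_r) :
  quad_form M (c *: v) = c ^+ 2 * quad_form M v.
Proof.
have tE : (c *: v)^T = c *: v^T by rewrite linearZ.
by rewrite /quad_form tE -!scalemxAl -scalemxAr scalerA -expr2 mxE.
Qed.

Lemma quad_form_convex (R : realType) (r : nat) (M : 'M[R]_r) (u e : 'cV[R]_r) (th : R) :
  quad_form M (u + th *: e) =
  (1 - th) * quad_form M u + th * quad_form M (u + e) - th * (1 - th) * quad_form M e.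
Proof.
have H (c : R) : quad_form M (u + c *: e) = quad_form M u +
    c * ((u^T *m M *m e) 0 0 + (e^T *m M *m u) 0 0) + c ^+ 2 * quad_form M e.
  have tE : (u + c *: e)^T = u^T + c *: e^T by rewrite linearD linearZ.
  rewrite /quad_form tE !mulmxDl !mulmxDr.
  rewrite -!scalemxAl -!scalemxAr.
  by rewrite !mxE; ring.
by rewrite -[in RHS](scale1r e) !H scale1r; ring.
Qed.

(* Each coordinate of x is rounded to one of the two neighbouring integers; along
   a coordinate the form is an interpolation, corrected by a multiple of its
   value at the basis vector. *)
Lemma quad_form_rounding (R : realType) (r : nat) (M : 'M[R]_r) (x : 'cV[R]_r) (A B : R) :
  0 <= B ->
  (forall z : 'cV[R]_r,
    (forall i, exists2 a : int, z i 0 = a%:~R & `|z i 0| <= `|x i 0| + 1) ->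
    `|quad_form M z| <= A) ->
  (forall i, `|quad_form M (delta_mx i 0)| <= B) ->
  `|quad_form M x| <= A + r%:R * B / 4.
Proof.
move=> B0 HA HB.
(* Induction on the number [k] of coordinates not yet rounded; each costs at most th (1 - th) B <=
   B/4. *)
suff H k (y : 'cV[R]_r) : (k <= r)%N -> (forall i : 'I_r, (i < k)%N -> y i 0 = x i 0) ->
    (forall i : 'I_r, (k <= i)%N -> exists2 a : int, y i 0 = a%:~R & `|y i 0| <= `|x i 0| + 1) ->
    `|quad_form M y| <= A + k%:R * B / 4.
  by apply: H => // i; rewrite leqNgt ltn_ord.
elim: k y => [|k IH] y kr yx yz; first by rewrite !mul0r addr0 HA// => i; exact: yz.
pose i0 := Ordinal kr.
pose a := Num.floor (x i0 0).
have /andP[a1 a2] := floor_itv (x i0 0).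
pose th := x i0 0 - a%:~R.
pose u : 'cV[R]_r := y - th *: delta_mx i0 0.
have uE i : u i 0 = if i == i0 then a%:~R else y i 0.
  rewrite !mxE; case: eqP => [->|_]; last by rewrite /= mulr0 subr0.
  by rewrite yx//= /th mulr1 subKr.
have u1E i : (u + delta_mx i0 0) i 0 = if i == i0 then (a + 1)%:~R else y i 0.
  rewrite mxE uE mxE; case: eqP => _ /=; last by rewrite addr0.
  by rewrite intrD.
have Hv (v : 'cV[R]_r) (c : int) : (forall i, v i 0 = if i == i0 then c%:~R else y i 0) ->
    `|c%:~R - x i0 0| <= 1 -> `|quad_form M v| <= A + k%:R * B / 4.
  move=> vE c1; apply: IH; first exact: ltnW.
    move=> i ik; rewrite vE ifN ?yx//; first exact: leqW.
    by rewrite -val_eqE/= neq_ltn ik.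
  move=> i ki; rewrite vE; have [ii0|ii0] := eqVneq i i0; last first.
    by apply: yz; rewrite ltn_neqAle ki andbT eq_sym.
  rewrite {}ii0; exists c => //; rewrite -lerBlDl; apply: le_trans c1.
  by apply: le_trans (lerB_dist _ _) _.
have Hu : `|quad_form M u| <= A + k%:R * B / 4.
  by apply: (Hv u a) => //; rewrite ler_norml; rewrite intrD in a2; lra.
have Hu1 : `|quad_form M (u + delta_mx i0 0)| <= A + k%:R * B / 4.
  by apply: (Hv _ (a + 1)) => //; rewrite ler_norml; rewrite intrD in a2 *; lra.
have -> : y = u + th *: delta_mx i0 0 by rewrite /u subrK.
rewrite quad_form_convex.
have th0 : 0 <= th by rewrite subr_ge0.
have th1 : th <= 1 by rewrite /th; rewrite intrD in a2; lra.
have tt : th * (1 - th) <= 1 / 4 by have := sqr_ge0 (th - 1 / 2); lra.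
have Hd := HB i0.
set A' := A + k%:R * B / 4 in Hu Hu1.
apply: (@le_trans _ _ ((1 - th) * A' + th * A' + 1 / 4 * B)).
  apply: le_trans (ler_normB _ _) _; apply: lerD.
    apply: le_trans (ler_normD _ _) _; rewrite !normrM.
    rewrite (ger0_norm th0) (@ger0_norm _ (1 - th)) ?subr_ge0//.
    by apply: lerD; rewrite ler_wpM2l ?subr_ge0.
  rewrite normrM ger0_norm ?mulr_ge0 ?subr_ge0//; apply: ler_pM => //.
  by rewrite mulr_ge0 ?subr_ge0.
by rewrite /A' -natr1; lra.
Qed.

(** Scale x to squared norm r. Rounding moves each coordinate by at most 1, so the rounded points
    have squared norm at most 2r + 2r; basis vectors are also net points. The form at the scaled
    vector is then at most 4 r eps + r eps / 4 <= 5 r eps. *)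
Lemma quad_form_integer_net (R : realType) (r : nat) (M : 'M[R]_r) (eps : R) :
  (0 < r)%N -> 0 <= eps ->
  (forall z : 'I_r -> int, \sum_i (z i)%:~R ^+ 2 <= 4 * r%:R :> R ->
    `|quad_form M (\col_i (z i)%:~R)| <= eps * \sum_i (z i)%:~R ^+ 2) ->
  forall x : 'cV[R]_r, `|quad_form M x| <= 5 * eps * \sum_i x i 0 ^+ 2.
Proof.
move=> r0 eps0 H x; set N := \sum_i _.
have rR : 1 <= r%:R :> R by rewrite ler1n.
have N0 : 0 <= N by apply: sumr_ge0 => i _; exact: sqr_ge0.
have [N00|Nn0] := eqVneq N 0.
  have -> : x = 0.
    apply/matrixP => i j; rewrite ord1 mxE; apply/eqP; rewrite -sqrf_eq0.
    by have /psumr_eq0P := N00 => -> // k _; exact: sqr_ge0.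
  by rewrite /quad_form mulmx0 mxE normr0 N00 mulr0.
have {}N0 : 0 < N by rewrite lt0r Nn0.
pose c := Num.sqrt (r%:R / N).
have c2 : c ^+ 2 = r%:R / N by rewrite sqr_sqrtr// divr_ge0// ltW.
have := @quad_form_rounding R r M (c *: x) (4 * r%:R * eps) eps eps0.
rewrite quad_formZ c2 normrM ger0_norm; last by rewrite divr_ge0// ltW.
have rN : 0 < r%:R / N by rewrite divr_gt0// ltr0n.
move=> H'; rewrite -(ler_pM2l rN).
apply: (le_trans (H' _ _)).
- move=> z zP.
  have zE : z = \col_i (Num.floor (z i 0))%:~R.
    apply/matrixP => i j; rewrite ord1 !mxE.
    by have [a -> _] := zP i; rewrite intrKfloor.
  have Z4 : \sum_i (Num.floor (z i 0))%:~R ^+ 2 <= 4 * r%:R :> R.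
    apply: (@le_trans _ _ (\sum_i (2 * (c *: x) i 0 ^+ 2 + 2))).
      apply: ler_sum => i _; have [a za] := zP i; rewrite za intrKfloor => a1.
      rewrite -real_normK ?num_real// -[X in _ <= 2 * X + _]real_normK ?num_real//.
      have := normr_ge0 (a%:~R : R); have := normr_ge0 ((c *: x) i 0).
      have := sqr_ge0 (`|(c *: x) i 0| - 1); nra.
    rewrite big_split/= -mulr_sumr sumr_const card_ord.
    under eq_bigr do rewrite mxE exprMn.
    rewrite -mulr_sumr c2 -/N divfK// -mulr_natr; lra.
  rewrite {1}zE; apply: le_trans (H _ Z4) _.
  by rewrite mulrC ler_wpM2r.
- move=> i; pose z (k : 'I_r) : int := (k == i)%:Z.
  have zz : \sum_k (z k)%:~R ^+ 2 = 1 :> R.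
    rewrite (bigD1 i)//= /z eqxx expr1n big1 ?addr0// => k /negbTE ->.
    by rewrite expr0n.
  have := H z; rewrite zz mulr1 => /(_ _).
  have -> : \col_k (z k)%:~R = delta_mx i 0 :> 'cV[R]_r.
    by apply/matrixP => k j; rewrite ord1 !mxE eqxx andbT /z; case: eqP.
  by apply; lra.
rewrite mulrCA divfK//; nra.
Qed.

(* Integers are encoded by sign and absolute value; the two codes of 0 only make
   the net larger. *)
Definition net_coord (R : realType) (B : nat) (u : bool * 'I_B.+1) : R :=
  (-1) ^+ u.1 * u.2%:R.

(** For integers the sum of |k_i| is at most the sum of k_i^2, hence at most 4r, so each net point
    has weight at least 1 under 2^(4r) times the product of the 2^(-|k_i|). One coordinate sums to
    at most 4, counting both signs, and 16 * 4 = 64. *)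
Lemma card_net (R : realType) (r B : nat) :
  #|[pred f : {ffun 'I_r -> bool * 'I_B.+1} |
    \sum_i net_coord R (f i) ^+ 2 <= 4 * r%:R]|%:R <= 64 ^+ r :> R.
Proof.
rewrite -sum1_card natr_sum.
apply: (@le_trans _ _ (\sum_(f : {ffun 'I_r -> bool * 'I_B.+1})
    2 ^+ (4 * r) * \prod_i 2^-1 ^+ (f i).2)).
  rewrite big_mkcond; apply: ler_sum => f _; rewrite inE; case: ifP => [H|_]; last first.
    by rewrite mulr_ge0 ?exprn_ge0//; apply: prodr_ge0 => i _; rewrite exprn_ge0// invr_ge0.
  rewrite prodrXr exprVn -[leLHS]mul1r ler_pdivlMr ?exprn_gt0// !mul1r.
  apply: ler_weXn2l; first by lra.
  rewrite -(ler_nat R) natr_sum natrM; apply: le_trans H; apply: ler_sum => i _.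
  rewrite /net_coord exprMn sqrr_sign mul1r -natrX ler_nat.
  by case: (nat_of_ord _) => // k; rewrite expnS leq_pmulr// expn_gt0.
rewrite -mulr_sumr (sum_prod_ffun (fun (_ : 'I_r) (u : bool * 'I_B.+1) => 2^-1 ^+ u.2)).
rewrite (_ : 64 ^+ r = 2 ^+ (4 * r) * 4 ^+ r :> R); last first.
  by rewrite exprM -exprMn; congr (_ ^+ _); ring.
rewrite ler_wpM2l ?exprn_ge0//.
rewrite -[X in _ <= _ ^+ X](card_ord r) -prodr_const; apply: ler_prod => i _.
apply/andP; split; first by apply: sumr_ge0 => u _; rewrite exprn_ge0// invr_ge0.
rewrite big_pair big_bool/=.
have H : \sum_(a < B.+1) 2^-1 ^+ a <= 2 - 2^-1 ^+ B :> R.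
  elim: B {i} => [|B IH]; first by rewrite big_ord_recl big_ord0 expr0; lra.
  by rewrite big_ord_recr/=; apply: le_trans (lerD IH (lexx _)) _; rewrite !exprS; lra.
have : 0 <= 2^-1 ^+ B :> R by rewrite exprn_ge0// invr_ge0.
lra.
Qed.

Lemma integer_point_in_net (R : realType) (r : nat) (z : 'I_r -> int) :
  \sum_i (z i)%:~R ^+ 2 <= 4 * r%:R :> R ->
  exists f : {ffun 'I_r -> bool * 'I_(4 * r).+1},
    forall i, net_coord R (f i) = (z i)%:~R.
Proof.
move=> H; exists [ffun i => (z i < 0, inord `|z i|%N)] => i.
rewrite ffunE /net_coord/= inordK.
  by rewrite [in RHS](intEsign (z i)) intrM rmorphXn/= rmorphN1.
have z4 : (`|z i| ^ 2 <= 4 * r)%N.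
  rewrite -(ler_nat R) natrM; apply: le_trans H.
  rewrite (bigD1 i)//= natrX natr_absz intr_norm real_normK ?num_real// lerDl.
  by apply: sumr_ge0 => k _; exact: sqr_ge0.
rewrite ltnS; apply: leq_trans z4.
by case: `|z i|%N => // k; rewrite expnS leq_pmulr// expn_gt0.
Qed.

(** * Rademacher sums, Walsh-Hadamard matrices and orthonormal bases *)

Lemma rademacher_tail (R : realType) (n : nat) (a : 'I_n -> R) (V tau : R) :
  0 < V -> 0 <= tau -> \sum_j a j ^+ 2 <= V ->
  \sum_(f : {ffun 'I_n -> bool}) (\prod_(j < n) 2^-1) *
    (tau < `|\sum_j (-1) ^+ f j * a j|)%R%:R <= 2 * expR (- (tau ^+ 2 / (8 * V))).
Proof.
(* The minimizer of the Chernoff exponent 2 th^2 V - th tau; below, c = 1 and c = -1 give the two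
   tails. *)
move=> V0 tau0 aV; pose th := tau / (4 * V).
have th0 : 0 <= th by rewrite divr_ge0// mulr_ge0// ltW.
have H (c : R) : c ^+ 2 = 1 ->
    \sum_(f : {ffun 'I_n -> bool}) (\prod_(j < n) 2^-1) *
      expR (th * (c * (\sum_j (-1) ^+ f j * a j) - tau)) <= expR (- (tau ^+ 2 / (8 * V))).
  move=> c2.
  have -> : \sum_(f : {ffun 'I_n -> bool}) (\prod_(j < n) 2^-1) *
      expR (th * (c * (\sum_j (-1) ^+ f j * a j) - tau)) =
      expR (- (th * tau)) *
      \prod_j ((expR (th * c * a j) + expR (- (th * c * a j))) / 2).
    transitivity (\sum_(f : {ffun 'I_n -> bool}) expR (- (th * tau)) *
        \prod_(j < n) (2^-1 * expR (th * c * ((-1) ^+ f j * a j)))).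
      apply: eq_bigr => f _; rewrite big_split/= -expR_sum -mulr_sumr mulrCA -expRD.
      by congr (_ * expR _); ring.
    rewrite -mulr_sumr; congr (_ * _).
    rewrite (sum_prod_ffun (fun j (x : bool) => 2^-1 * expR (th * c * ((-1) ^+ x * a j)))).
    apply: eq_bigr => j _; rewrite big_bool/= expr1 expr0 mulN1r mul1r mulrN; lra.
  apply: (@le_trans _ _ (expR (- (th * tau)) * expR (2 * th ^+ 2 * V))).
    rewrite ler_wpM2l ?expR_ge0//.
    apply: (@le_trans _ _ (\prod_j expR (2 * th ^+ 2 * a j ^+ 2))).
      apply: ler_prod => j _; rewrite divr_ge0 ?addr_ge0 ?expR_ge0//=.
      by apply: le_trans (cosh_le _) _; rewrite !exprMn c2 mulr1 mulrA.
    rewrite -expR_sum ler_expR -mulr_sumr ler_wpM2l//.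
    by rewrite mulr_ge0// sqr_ge0.
  rewrite -expRD ler_expR le_eqVlt; apply/orP; left; apply/eqP.
  by rewrite /th; field; rewrite lt0r_neq0.
apply: (@le_trans _ _ (\sum_(f : {ffun 'I_n -> bool}) ((\prod_(j < n) 2^-1) *
      expR (th * (1 * (\sum_j (-1) ^+ f j * a j) - tau)) + (\prod_(j < n) 2^-1) *
      expR (th * (-1 * (\sum_j (-1) ^+ f j * a j) - tau))))); last first.
  by rewrite big_split/= mulr_natl mulr2n; apply: lerD; apply: H; rewrite ?sqrrN expr1n.
apply: ler_sum => f _; rewrite -mulrDr ler_wpM2l//.
  by apply: prodr_ge0 => j _; rewrite invr_ge0.
set X := \sum_j _; case: ltP => [tX|_]; last by rewrite addr_ge0 ?expR_ge0.
have E1 (x : R) : tau < x -> 1 <= expR (th * (x - tau)).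
  move=> tx; apply: le_trans (expR_ge1Dx _).
  by rewrite lerDl mulr_ge0// subr_ge0 ltW.
rewrite mul1r mulN1r.
have [X0|X0] := leP 0 X.
  by rewrite (ger0_norm X0) in tX; rewrite -[leLHS]addr0 lerD ?expR_ge0// E1.
by rewrite (ltr0_norm X0) in tX; rewrite -[leLHS]add0r lerD ?expR_ge0// E1.
Qed.

Lemma binary_digit_double (i : nat) (b : bool) (l : nat) :
  binary_digit (b + i.*2) l.+1 = binary_digit i l.
Proof. by rewrite /binary_digit expnS divnMA divn2 half_bit_double. Qed.

Lemma binary_digit0 (i : nat) (b : bool) : binary_digit (b + i.*2) 0 = b.
Proof. by rewrite /binary_digit expn0 divn1 oddD odd_double addbF oddb. Qed.

Lemma sum_ord_double (R : realType) (F : nat -> R) (n : nat) :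
  \sum_(i < n.*2) F i = \sum_(i < n) (F i.*2 + F i.*2.+1).
Proof.
elim: n => [|n IH]; first by rewrite !big_ord0.
by rewrite doubleS !big_ord_recr/= IH addrA.
Qed.

(** Summing over i < 2^k is summing independently over its bits; the induction peels off the lowest
    one. *)
Lemma sum_prod_binary_digit (R : realType) (g : nat -> nat -> R) (k : nat) :
  \sum_(i < 2 ^ k) \prod_(l < k) g l (binary_digit i l) =
  \prod_(l < k) (g l 0%N + g l 1%N).
Proof.
elim: k g => [|k IH] g; first by rewrite expn0 big_ord_recl !big_ord0 addr0.
rewrite expnS mul2n.
rewrite (sum_ord_double (fun i => \prod_(l < k.+1) g l (binary_digit i l))).
rewrite [RHS]big_ord_recl -(IH (fun l => g l.+1)) mulr_sumr; apply: eq_bigr => i _.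
rewrite !big_ord_recl/= mulrDl; congr (_ * _ + _ * _).
- by rewrite (binary_digit0 i false).
- by apply: eq_bigr => l _; rewrite (binary_digit_double i false).
- by rewrite (binary_digit0 i true).
- by apply: eq_bigr => l _; rewrite (binary_digit_double i true).
Qed.

Lemma binary_digit_inj (k i j : nat) : (i < 2 ^ k)%N -> (j < 2 ^ k)%N ->
  (forall l, (l < k)%N -> binary_digit i l = binary_digit j l) -> i = j.
Proof.
elim: k i j => [|k IH] i j; first by rewrite expn0 !ltnS !leqn0 => /eqP -> /eqP ->.
rewrite -(odd_double_half i) -(odd_double_half j) expnS mul2n => ik jk H.
have := H 0%N isT; rewrite !binary_digit0 => ->; congr (_ + _.*2)%N.
apply: IH; [lia|lia|move=> l lk].
by have := H l.+1 lk; rewrite !binary_digit_double.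
Qed.

(** The inner product of two columns factors over the bits, and a bit where the column indices
    differ contributes 1 - 1 = 0. *)
Lemma walsh_hadamard_orthogonal (R : realType) (k : nat) :
  (walsh_hadamard R (2 ^ k))^T *m walsh_hadamard R (2 ^ k) = 1%:M.
Proof.
set n := (2 ^ k)%N; have n0 : 0 < n%:R :> R by rewrite ltr0n expn_gt0.
have s0 : Num.sqrt n%:R != 0 :> R by rewrite sqrtr_eq0 -ltNge.
have ss : (Num.sqrt n%:R)^-1 * (Num.sqrt n%:R)^-1 = n%:R^-1 :> R.
  by rewrite -invfM -expr2 sqr_sqrtr// ltW.
apply/matrixP => j j'; rewrite !mxE.
pose g l d : R := (-1) ^+ (d * binary_digit j l) * (-1) ^+ (d * binary_digit j' l).
transitivity (n%:R^-1 * \sum_(i < 2 ^ k) \prod_(l < k) g l (binary_digit i l)).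
  rewrite mulr_sumr; apply: eq_bigr => i _.
  rewrite !mxE trunc_expnK// mulrACA ss; congr (_ * _).
  by rewrite !expr_sum -big_split.
rewrite sum_prod_binary_digit.
have [jE|jj'] := eqVneq j j'.
  rewrite (eq_bigr (fun=> 2)) ?prodr_const ?card_ord; last first.
    by move=> l _; rewrite /g jE !mul0n !mul1n !expr0 mulr1 -expr2 sqrr_sign.
  by rewrite -natrX mulVf// lt0r_neq0.
have [l dl] : exists l : 'I_k, binary_digit j l != binary_digit j' l.
  apply/existsP; rewrite -negb_forall; apply: contraNN jj' => /forallP H.
  apply/eqP/val_inj; apply: (@binary_digit_inj k); rewrite ?ltn_ord// => l lk.
  exact/eqP/(H (Ordinal lk)).
rewrite (bigD1 l)//= (_ : g l 0%N + g l 1%N = 0) ?mul0r ?mulr0//.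
move: dl; rewrite /g /binary_digit !mul0n !mul1n.
by case: (odd _); case: (odd _) => //= _; rewrite ?expr0 ?expr1; lra.
Qed.

Lemma walsh_hadamard_sqr (R : realType) (n : nat) (i j : 'I_n) :
  walsh_hadamard R n i j ^+ 2 = n%:R^-1.
Proof. by rewrite mxE exprMn sqrr_sign mulr1 exprVn sqr_sqrtr. Qed.

Lemma norm2_sqr (R : realType) (n : nat) (x : 'cV[R]_n) :
  norm2 x ^+ 2 = \sum_i x i 0 ^+ 2.
Proof. by rewrite sqr_sqrtr// sumr_ge0// => i _; exact: sqr_ge0. Qed.

Lemma norm2_sqrE (R : realType) (n : nat) (x : 'cV[R]_n) :
  norm2 x ^+ 2 = (x^T *m x) 0 0.
Proof. by rewrite norm2_sqr mxE; apply: eq_bigr => i _; rewrite mxE expr2. Qed.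

Lemma norm2_isometry (R : realType) (n r : nat) (V : 'M[R]_(n, r)) (x : 'cV[R]_r) :
  V^T *m V = 1%:M -> norm2 (V *m x) ^+ 2 = norm2 x ^+ 2.
Proof.
by move=> VV; rewrite !norm2_sqrE trmx_mul mulmxA -(mulmxA x^T) VV mulmx1.
Qed.

Lemma gram_schmidt_rows (R : realType) (r n : nat) (V : 'M[R]_(r, n)) :
  row_free V -> exists2 U : 'M[R]_(r, n), U *m U^T = 1%:M & (V <= U)%MS.
Proof.
elim: r V => [|r IH] V Vf.
  by exists 0; [apply/matrixP => -[]|rewrite [V]flatmx0 sub0mx].
have V' : V = col_mx (usubmx (V : 'M[R]_(1 + r, n))) (dsubmx (V : 'M[R]_(1 + r, n))).
  by rewrite vsubmxK.
set v := usubmx (V : 'M[R]_(1 + r, n)) in V'; set W := dsubmx (V : 'M[R]_(1 + r, n)) in V'.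
have rV : \rank (v + W)%MS = r.+1 by rewrite addsmxE -V' (eqP Vf).
have Wf : row_free W.
  rewrite /row_free eqn_leq rank_leq_row/=.
  have := (mxrank_adds_leqif v W).1; rewrite rV => H.
  by have := leq_trans H (leq_add (rank_leq_row v) (leqnn _)); rewrite add1n ltnS.
have [U UU WU] := IH W Wf.
pose w := v - v *m U^T *m U.
have wU : w *m U^T = 0 by rewrite mulmxBl -(mulmxA (v *m U^T)) UU mulmx1 subrr.
(* Otherwise [v] and [W] would both lie in the row space of [U], of rank at most r, while together
   they have rank r + 1. *)
have w0 : 0 < \sum_j w 0 j ^+ 2.
  rewrite lt0r sumr_ge0 ?andbT; last by move=> j _; exact: sqr_ge0.
  apply/negP => /eqP/psumr_eq0P => H.
  have {}H : w = 0.
    apply/matrixP => i j; rewrite ord1 [RHS]mxE; apply/eqP; rewrite -sqrf_eq0.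
    by rewrite H// => k _; exact: sqr_ge0.
  have vU : (v <= U)%MS.
    by move/eqP: H; rewrite subr_eq0 => /eqP ->; exact: submxMl.
  have : (v + W <= U)%MS by rewrite addsmx_sub vU.
  by move=> /mxrankS; rewrite rV leqNgt ltnS rank_leq_row.
set N := \sum_j _ in w0; pose c := (Num.sqrt N)^-1.
have c0 : c != 0 by rewrite invr_eq0 sqrtr_eq0 -ltNge.
have ww : w *m w^T = N%:M.
  apply/matrixP => i j; rewrite !ord1 mxE [RHS]mxE eqxx mulr1n.
  by apply: eq_bigr => k _; rewrite [X in _ * X]mxE -expr2.
have c2N : c * (c * N) = 1.
  by rewrite mulrA -expr2 exprVn sqr_sqrtr ?ltW// mulVf// lt0r_neq0.
pose U1 : 'M[R]_(1 + r, n) := col_mx (c *: w) U.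
have UU1 : (U <= U1)%MS by rewrite /U1 -addsmxE addsmxSr.
have UU1I : U1 *m U1^T = 1%:M.
  rewrite /U1 tr_col_mx mul_col_row UU.
  have tE : (c *: w)^T = c *: w^T by rewrite linearZ.
  have Uw : U *m w^T = 0 by rewrite -[LHS]trmxK trmx_mul trmxK wU trmx0.
  rewrite tE -!scalemxAl -!scalemxAr wU Uw !scaler0 ww !scale_scalar_mx c2N.
 by rewrite -scalar_mx_block.
exists U1; first exact: UU1I.
suff VU : (col_mx v W <= U1)%MS by rewrite V'; exact: VU.
rewrite -addsmxE addsmx_sub (submx_trans WU UU1) andbT.
rewrite -[v](subrK (v *m U^T *m U)) -/w addmx_sub//; last first.
  by apply: submx_trans UU1; exact: submxMl.
rewrite -[w]scale1r -(mulVf c0) -scalerA scalemx_sub//.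
by rewrite /U1 -addsmxE addsmxSl.
Qed.

Lemma orthonormal_factor (R : realType) (n d : nat) (A : 'M[R]_(n, d)) :
  exists (U : 'M[R]_(n, \rank A)) (B : 'M[R]_(\rank A, d)),
    U^T *m U = 1%:M /\ A = U *m B.
Proof.
have [|U UU /submxP[D cE]] := @gram_schmidt_rows R _ _ (col_base A)^T.
  by rewrite /row_free mxrank_tr (eqP (col_base_full A)) .
exists U^T, (D^T *m row_base A); split; first by rewrite trmxK.
by rewrite mulmxA -trmx_mul -cE trmxK mulmx_base.
Qed.

(** * Bad realizations of the hashing and of the signs *)

Definition hash_mx (R : realType) (m n s : nat)
    (x : {ffun 'I_n -> s.-tuple 'I_m} * {ffun 'I_n * 'I_s -> bool}) : 'M[R]_(m, n) :=
  \matrix_(i, j) \sum_(k < s | tnth (x.1 j) k == i) (-1) ^+ x.2 (j, k) / Num.sqrt s%:R.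

Lemma sqr_sum_off_diag (R : realType) (n : nat) (y c : 'I_n -> R) :
  (\sum_j c j * y j) ^+ 2 = \sum_j c j ^+ 2 * y j ^+ 2 + off_diag_form y c.
Proof.
rewrite expr2 mulr_suml; under eq_bigr do rewrite mulr_sumr.
rewrite pair_bigA/= (bigID (fun z : 'I_n * 'I_n => z.1 == z.2))/=; congr (_ + _).
rewrite -(pair_big_dep predT (fun i j => i == j)
  (fun i j => c i * y i * (c j * y j)))/=; apply: eq_bigr => j _.
rewrite (big_pred1 j); last by move=> i; rewrite /= eq_sym.
by rewrite mulrACA -!expr2.
Qed.

(** When the indices are distinct each column has exactly [s] entries of absolute value 1 before
    scaling, so the diagonal terms reproduce |y|^2 exactly. *)
Lemma norm2_hash_mx (R : realType) (m n s : nat)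
    (t : {ffun 'I_n -> s.-tuple 'I_m}) (b : {ffun 'I_n * 'I_s -> bool}) (y : 'cV[R]_n) :
  (0 < s)%N -> (forall j, uniq (t j)) ->
  norm2 (hash_mx R (t, b) *m y) ^+ 2 - norm2 y ^+ 2 =
  (s%:R)^-1 * \sum_i off_diag_form (fun j => y j 0) (fun j => hash_entry R t b (i, j)).
Proof.
move=> s0 ut; have sR : 0 < s%:R :> R by rewrite ltr0n.
have HE i : (hash_mx R (t, b) *m y) i 0 =
    (Num.sqrt s%:R)^-1 * \sum_j hash_entry R t b (i, j) * y j 0.
  rewrite mxE mulr_sumr; apply: eq_bigr => j _; rewrite mxE -mulr_suml mulrCA mulrA.
  by rewrite mulrAC.
rewrite !norm2_sqr; under eq_bigr do rewrite HE exprMn sqr_sum_off_diag.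
rewrite -mulr_sumr exprVn sqr_sqrtr ?ltW// big_split/= mulrDr addrAC.
suff -> : \sum_i \sum_j hash_entry R t b (i, j) ^+ 2 * y j 0 ^+ 2 =
    s%:R * \sum_j y j 0 ^+ 2.
  by rewrite mulKf ?lt0r_neq0// subrr add0r.
rewrite exchange_big/= mulr_sumr; apply: eq_bigr => j _.
rewrite -mulr_suml; congr (_ * _).
under eq_bigr do rewrite -real_normK ?num_real// hash_entry_norm//= -natrX.
rewrite -natr_sum; congr (_%:R).
rewrite -[RHS](size_tuple (t j)) -(card_uniqP (ut j)) -sum1_card [RHS]big_mkcond/=.
by apply: eq_bigr => i _; case: (i \in t j).
Qed.

Lemma sum_hash_weight_union (R : realType) (m n s : nat) (I : finType) (A : pred I)
    (B : pred ({ffun 'I_n -> s.-tuple 'I_m} * {ffun 'I_n * 'I_s -> bool}))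
    (C : I -> {ffun 'I_n -> s.-tuple 'I_m} -> {ffun 'I_n * 'I_s -> bool} -> bool) (d : R) :
  (forall (t : {ffun 'I_n -> s.-tuple 'I_m}) b, (forall j, uniq (t j)) -> B (t, b) ->
    exists2 i, A i & C i t b) ->
  (forall i, A i -> \sum_t \sum_b hash_weight R t b * (C i t b)%:R <= d) ->
  \sum_(x | B x) hash_weight R x.1 x.2 <= #|A|%:R * d.
Proof.
move=> BC Cd; apply: (@le_trans _ _ (\sum_(i | A i) \sum_t \sum_b
    hash_weight R t b * (C i t b)%:R)); last first.
  rewrite mulr_natl -sumr_const; apply: ler_sum => i Ai; exact: Cd.
under [leRHS]eq_bigr do rewrite pair_bigA/=.
rewrite exchange_big/= big_mkcond/=; apply: ler_sum => -[t b] _ /=.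
rewrite -mulr_sumr; have hw0 := hash_weight_ge0 R t b.
case: ifP => [Bx|_]; last by rewrite mulr_ge0// sumr_ge0.
have [/forallP ut|/forallPn[j uj]] := boolP [forall j, uniq (t j)]; last first.
  by rewrite /hash_weight (bigD1 j)//= /tuple_weight (negbTE uj) !mul0r.
have [i Ai Ci] := BC t b ut Bx.
rewrite -[leLHS]mulr1 ler_wpM2l// (bigD1 i)//= Ci lerDl.
by apply: sumr_ge0.
Qed.

Definition net_vec (R : realType) (r B : nat) (f : {ffun 'I_r -> bool * 'I_B.+1}) :
  'cV[R]_r := \col_i net_coord R (f i).

Lemma norm2_net_vec (R : realType) (r B : nat) (f : {ffun 'I_r -> bool * 'I_B.+1}) :
  norm2 (net_vec R f) ^+ 2 = \sum_i net_coord R (f i) ^+ 2.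
Proof. by rewrite norm2_sqr; apply: eq_bigr => i _; rewrite mxE. Qed.

Definition in_net (R : realType) (r : nat) (f : {ffun 'I_r -> bool * 'I_(4 * r).+1}) :
  bool := (\sum_i net_coord R (f i) ^+ 2 <= 4 * r%:R).

Definition flat_on_net (R : realType) (n r : nat) (V : 'M[R]_(n, r)) (nu : R) : bool :=
  [forall f : {ffun 'I_r -> bool * 'I_(4 * r).+1}, in_net R f ==>
    [forall i, `|(V *m net_vec R f) i 0| <= nu * norm2 (net_vec R f)]].

Lemma embedding_of_net (R : realType) (m n r d : nat) (eps : R) (S : 'M[R]_(m, n))
    (V W : 'M[R]_(n, r)) (A : 'M[R]_(n, d)) (B : 'M[R]_(r, d)) (Q : 'M[R]_n) :
  (0 < r)%N -> 0 <= eps -> V = Q *m W -> W^T *m W = 1%:M -> A = W *m B ->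
  (forall f : {ffun 'I_r -> bool * 'I_(4 * r).+1}, in_net R f ->
    `|norm2 (S *m (V *m net_vec R f)) ^+ 2 - norm2 (net_vec R f) ^+ 2| <=
      eps / 5 * norm2 (net_vec R f) ^+ 2) ->
  subspace_embedding eps (S *m Q) A.
Proof.
move=> r0 eps0 VE WW AE H x.
set v := B *m x.
have Av : A *m x = W *m v by rewrite AE -mulmxA.
have Sv : S *m Q *m (A *m x) = S *m (V *m v) by rewrite Av VE !mulmxA.
rewrite Sv Av (norm2_isometry v WW).
(* The distortion is a quadratic form in the r coordinates with respect to the orthonormal basis, so
   the integer net lives in dimension r and not n. *)
pose M := (S *m V)^T *m (S *m V) - 1%:M.
have ME z : quad_form M z = norm2 (S *m (V *m z)) ^+ 2 - norm2 z ^+ 2.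
  have -> : quad_form M z = ((S *m (V *m z))^T *m (S *m (V *m z)) - z^T *m z) 0 0.
    by rewrite /quad_form /M mulmxBr mulmx1 mulmxBl (mulmxA S V) (trmx_mul (S *m V)) !mulmxA.
  by rewrite !norm2_sqrE mxE [X in _ + X]mxE.
have := @quad_form_integer_net R r M (eps / 5) r0 _ _ v.
rewrite ME -norm2_sqr (_ : 5 * (eps / 5) = eps); last by field.
move=> /(_ _ _)/ler_normlP[].
- by rewrite divr_ge0.
- move=> z z4; have [f fz] := integer_point_in_net z4.
  have -> : \col_i (z i)%:~R = net_vec R f.
    by apply/matrixP => i j; rewrite ord1 !mxE fz.
  have -> : \sum_i (z i)%:~R ^+ 2 = norm2 (net_vec R f) ^+ 2.
    by rewrite norm2_net_vec; apply: eq_bigr => i _; rewrite fz.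
  rewrite ME; apply: H; rewrite /in_net; apply: le_trans z4.
  by apply: ler_sum => i _; rewrite fz.
- by lra.
Qed.

Lemma hash_bad_weight (R : realType) (m n s p r d : nat) (Q : 'M[R]_n)
    (W : 'M[R]_(n, r)) (A : 'M[R]_(n, d)) (B : 'M[R]_(r, d))
    (nu b E C2 eps L : R) :
  let lam := expR 3 * p%:R / (eps / 5 * s%:R) in
  (0 < s)%N -> (s <= m)%N -> (0 < p)%N -> ~~ odd p -> 0 <= b -> 1 <= E ->
  0 < C2 -> 0 < eps -> 0 < L -> C2 * eps <= 1 -> 10 * expR 5 * C2 <= 2^-1 ->
  E * L <= m%:R * C2 ^+ 2 * eps ^+ 2 -> L <= p%:R <= 2 * L ->
  4 * (lam * nu ^+ 2) <= ln E -> lam * nu ^+ 2 * p%:R <= b ^+ 2 ->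
  6 * b <= ln (E / (C2 * eps)) ->
  (0 < r)%N -> W^T *m W = 1%:M -> Q^T *m Q = 1%:M -> A = W *m B ->
  flat_on_net (Q *m W) nu ->
  \sum_(x | ~~ `[< subspace_embedding eps (@hash_mx R m n s x *m Q) A >])
    hash_weight R x.1 x.2 <= 64 ^+ r * expR (- (2 * L)).
Proof.
move=> lam s0 sm p0 ep b0 E1 C20 eps0 L0 Ce GC mE pL bE bp bX r0 WW QQ AE flat.
pose V := Q *m W.
have VV : V^T *m V = 1%:M.
  by rewrite /V trmx_mul mulmxA -(mulmxA W^T) QQ mulmx1.
have sR : 0 < s%:R :> R by rewrite ltr0n.
(* The union bound runs over nonzero net points, which can be normalized; at 0 the required
   inequality is trivial. *)
pose D : pred {ffun 'I_r -> bool * 'I_(4 * r).+1} :=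
  fun f => in_net R f && (norm2 (net_vec R f) != 0).
pose y (f : {ffun 'I_r -> bool * 'I_(4 * r).+1}) : 'cV[R]_n :=
  (norm2 (net_vec R f))^-1 *: (V *m net_vec R f).
apply: (@le_trans _ _ (#|D|%:R * expR (- (2 * L)))); last first.
  rewrite ler_wpM2r ?expR_ge0//; apply: le_trans (card_net R r (4 * r)).
  by rewrite ler_nat subset_leq_card//; apply/fintype.subsetP => f /andP[].
apply: (@sum_hash_weight_union _ _ _ _ _ D _ (fun f t c => eps / 5 * s%:R <
    `|\sum_i off_diag_form (fun j => y f j 0) (fun j => hash_entry R t c (i, j))|)).
  move=> t c ut /asboolPn bad; apply: contrapT => none; apply: bad.
  apply: (@embedding_of_net _ _ _ _ _ _ _ V W A B) => //; first exact: ltW.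
  move=> f ff; set z := net_vec R f.
  have [z0|z0] := eqVneq (norm2 z) 0.
    have Vz0 : norm2 (V *m z) ^+ 2 = 0 by rewrite norm2_isometry// z0 expr0n.
    have -> : V *m z = 0.
      move: Vz0; rewrite norm2_sqr => /psumr_eq0P Vz0.
      apply/matrixP => i j; rewrite ord1 [RHS]mxE; apply/eqP; rewrite -sqrf_eq0.
      by rewrite Vz0// => k _; exact: sqr_ge0.
    rewrite mulmx0 z0 norm2_sqr big1 ?expr0n ?subrr ?normr0 ?mulr0//.
    by move=> i _; rewrite mxE expr0n.
  have z2 : 0 < norm2 z ^+ 2 by rewrite lt0r sqr_ge0 sqrf_eq0 z0.
  have -> : V *m z = norm2 z *: y f by rewrite /y scalerA mulfV// scale1r.
  have nZ k (c' : R) (u : 'cV[R]_k) : norm2 (c' *: u) ^+ 2 = c' ^+ 2 * norm2 u ^+ 2.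
    rewrite !norm2_sqr mulr_sumr; apply: eq_bigr => i _.
    by rewrite mxE exprMn.
  rewrite -scalemxAr nZ.
  have yf : norm2 (y f) ^+ 2 = 1.
    by rewrite /y nZ norm2_isometry// -exprMn mulVf// expr1n.
  have -> : norm2 z ^+ 2 * norm2 (hash_mx R (t, c) *m y f) ^+ 2 - norm2 z ^+ 2 =
      (norm2 (hash_mx R (t, c) *m y f) ^+ 2 - norm2 (y f) ^+ 2) * norm2 z ^+ 2.
    by rewrite yf; ring.
  rewrite norm2_hash_mx// normrM (ger0_norm (ltW z2)) ler_pM2r//.
  rewrite normrM (@ger0_norm _ (s%:R)^-1) ?invr_ge0 ?(ltW sR)// mulrC ler_pdivrMr// leNgt.
  by apply/negP => bad; apply: none; exists f => //; rewrite /D ff.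
move=> f /andP[ff z0]; apply: (@hash_tail R m n s p _ nu b E C2 eps L) => //.
  have zn : 0 < norm2 (net_vec R f) by rewrite lt0r z0 sqrtr_ge0.
  move=> j; rewrite mxE normrM ger0_norm ?invr_ge0 ?(ltW zn)// mulrC ler_pdivrMr//.
  by have /forallP/(_ f)/implyP/(_ ff)/forallP := flat; apply.
rewrite -norm2_sqr /y norm2_sqr le_eqVlt; apply/orP; left; apply/eqP.
under eq_bigr do rewrite mxE exprMn.
by rewrite -mulr_sumr -norm2_sqr norm2_isometry// -exprMn mulVf// expr1n.
Qed.

Definition sign_diag (R : realType) (n : nat) (f : {ffun 'I_n -> bool}) : 'M[R]_n :=
  diag_mx (\row_j (-1) ^+ f j).

Lemma sign_diag_orthogonal (R : realType) (n : nat) (f : {ffun 'I_n -> bool}) :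
  (sign_diag R f)^T *m sign_diag R f = 1%:M.
Proof.
rewrite /sign_diag tr_diag_mx mulmx_diag -diag_const_mx; congr diag_mx.
by apply/rowP => j; rewrite !mxE -expr2 sqrr_sign.
Qed.

(** Union bound over at most 64^r n pairs of a net point and a coordinate, each failing with weight
    at most 2 exp(-n nu^2 / 8). The term 60 r leaves at least 7 r after division by 8, and 2 * 64^r
    <= 2^(7r) <= e^(7r). *)
Lemma sign_bad_weight (R : realType) (n r : nat) (W : 'M[R]_(n, r)) (nu delta1 : R) :
  (0 < r)%N -> (0 < n)%N -> W^T *m W = 1%:M -> 0 < delta1 -> 0 <= nu ->
  8 * ln (n%:R / delta1) + 60 * r%:R <= n%:R * nu ^+ 2 ->
  \sum_(f : {ffun 'I_n -> bool} |
      ~~ flat_on_net (walsh_hadamard R n *m sign_diag R f *m W) nu)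
    \prod_(j < n) 2^-1 <= delta1.
Proof.
move=> r0 n0 WW d10 nu0 nnu.
have nR : 0 < n%:R :> R by rewrite ltr0n.
have h0 : 0 <= \prod_(j < n) (2^-1 : R) by apply: prodr_ge0 => j _; rewrite invr_ge0.
pose D : pred ({ffun 'I_r -> bool * 'I_(4 * r).+1} * 'I_n) := fun u => in_net R u.1.
pose c (u : {ffun 'I_r -> bool * 'I_(4 * r).+1} * 'I_n) (f : {ffun 'I_n -> bool}) :=
  nu * norm2 (net_vec R u.1) <
  `|\sum_j (-1) ^+ f j * (walsh_hadamard R n u.2 j * (W *m net_vec R u.1) j 0)|.
apply: (@le_trans _ _ (\sum_(u | D u) 2 * expR (- (n%:R * nu ^+ 2 / 8)))); last first.
  rewrite sumr_const -[leLHS]mulr_natl.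
  have -> : #|D| = (#|[pred f | @in_net R r f]| * n)%N.
    transitivity #|[predX [pred f | @in_net R r f] & 'I_n]|.
      by apply: eq_card => u; rewrite !inE andbT.
    by rewrite cardX card_ord.
  apply: (@le_trans _ _ (64 ^+ r * n%:R * (2 * expR (- (n%:R * nu ^+ 2 / 8))))).
    by rewrite natrM ler_wpM2r ?mulr_ge0 ?expR_ge0// ler_wpM2r// card_net.
  apply: (@le_trans _ _ (64 ^+ r * n%:R * (2 * expR (- (ln (n%:R / delta1) + r%:R * 7))))).
    rewrite ler_wpM2l ?mulr_ge0 ?exprn_ge0// ler_wpM2l// ler_expR.
    have : 0 <= r%:R :> R by []. lra.
  rewrite expRN expRD lnK ?posrE ?divr_gt0// expRM_natl.
  have e7 : 2 ^+ 7 <= expR 7 :> R.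
    rewrite -[X in expR X]mulr1 expRM_natl lerXn2r ?nnegrE ?expR_ge0//.
    by have := expR_ge1Dx (1 : R); lra.
  have : 64 ^+ r * 2 <= expR 7 ^+ r :> R.
    apply: (@le_trans _ _ ((2 ^+ 7) ^+ r)); last by rewrite lerXn2r ?nnegrE ?expR_ge0.
    rewrite (_ : 2 ^+ 7 = 64 * 2 :> R); last by ring.
    rewrite exprMn ler_wpM2l ?exprn_ge0//.
    by case: r r0 {W D c WW nnu e7} => // r _; rewrite exprS ler_peMr// exprn_ege1// ler1n.
  have e7r : 0 < expR 7 ^+ r :> R by rewrite exprn_gt0// expR_gt0.
  move=> H; rewrite invfM invf_div.
  rewrite (_ : _ * _ = 64 ^+ r * 2 * delta1 / expR 7 ^+ r); last first.
    by field; rewrite !lt0r_neq0.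
  by rewrite ler_pdivrMr// mulrC ler_pM2l.
apply: (@le_trans _ _ (\sum_(u | D u) \sum_(f : {ffun 'I_n -> bool})
    (\prod_(j < n) 2^-1) * (c u f)%:R)).
  rewrite exchange_big/= big_mkcond/=; apply: ler_sum => f _; rewrite -mulr_sumr.
  case: ifPn => [/forallPn[g]|_]; last by rewrite mulr_ge0// sumr_ge0.
  rewrite negb_imply => /andP[gn /forallPn[i]]; rewrite -ltNge => gi.
  rewrite -[leLHS]mulr1 ler_wpM2l// (bigD1 (g, i))//= (_ : c (g, i) f) ?lerDl ?sumr_ge0//.
  rewrite /c/=; move: gi; rewrite -!mulmxA mxE.
  congr (_ < `|_|); apply: eq_bigr => j _.
  by rewrite /sign_diag mul_diag_mx !mxE mulrCA.
apply: ler_sum => -[g i] gn; rewrite /c/=; set z := net_vec R g.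
have [z0|z0] := eqVneq (norm2 z) 0.
  have Wz j : (W *m z) j 0 = 0.
    have : norm2 (W *m z) ^+ 2 = 0 by rewrite norm2_isometry// z0 expr0n.
    rewrite norm2_sqr => /psumr_eq0P Wz0; apply/eqP; rewrite -sqrf_eq0.
    by rewrite Wz0// => k _; exact: sqr_ge0.
  rewrite big1 ?mulr_ge0 ?expR_ge0// => f _.
  rewrite z0 mulr0 [X in `|X|]big1 ?normr0 ?ltxx ?mulr0// => j _.
  by rewrite Wz !mulr0.
have z2 : 0 < norm2 z ^+ 2 by rewrite lt0r sqr_ge0 sqrf_eq0 z0.
have -> : n%:R * nu ^+ 2 / 8 = (nu * norm2 z) ^+ 2 / (8 * (norm2 z ^+ 2 / n%:R)).
  by field; rewrite z0 lt0r_neq0.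
apply: rademacher_tail.
- by rewrite divr_gt0.
- by rewrite mulr_ge0// sqrtr_ge0.
under eq_bigr do rewrite exprMn walsh_hadamard_sqr.
by rewrite -mulr_sumr -norm2_sqr norm2_isometry// mulrC.
Qed.

(** * From finite sums to probabilities *)

Lemma fin_preimage_measurable (R : realType) (disp : measure_display)
    (T : measurableType disp) (P : probability T R) (U : finType) (X : T -> U) (B : pred U) :
  (forall u, measurable (X @^-1` [set u])) ->
  measurable (X @^-1` [set u | B u]) /\
  P (X @^-1` [set u | B u]) = (\sum_(u | B u) fine (P (X @^-1` [set u])))%:E.
Proof.
move=> mX.
have E : X @^-1` [set u | B u] = \bigcup_(u in [set` enum B]) X @^-1` [set u].
  apply/seteqP; split => w /=.
    by move=> BX; exists (X w) => //=; rewrite mem_enum.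
  by move=> [u /=]; rewrite mem_enum => Bu ->.
have fE : finite_set [set` enum B] by exact: finite_seq.
split; first by rewrite E; exact: fin_bigcup_measurable.
rewrite E measure_fin_bigcup//; last first.
  by move=> i j _ _ [w [/= <- <-]].
rewrite -fsbig_seq ?enum_uniq// big_enum/= -sumEFin; apply: eq_bigr => u _.
by rewrite fineK// fin_num_measure.
Qed.

Lemma sum_fin_law (R : realType) (disp : measure_display)
    (T : measurableType disp) (P : probability T R) (U : finType) (X : T -> U) :
  (forall u, measurable (X @^-1` [set u])) ->
  \sum_u fine (P (X @^-1` [set u])) = 1.
Proof.
move=> mX; have [_] := fin_preimage_measurable P predT mX.
have -> : X @^-1` [set u | predT u] = setT by apply/seteqP; split.
by rewrite probability_setT => -[].
Qed.

Lemma prob_independent_family (R : realType) (disp : measure_display)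
    (T : measurableType disp) (P : probability T R) (I U : finType)
    (X : I -> T -> U) (p : U -> R) (u : {ffun I -> U}) :
  mutually_independent P X -> (forall i v, measurable (X i @^-1` [set v])) ->
  (forall i v, P (X i @^-1` [set v]) = (p v)%:E) ->
  measurable ((fun w => X^~ w) @^-1` [set (u : I -> U)]) /\
  P ((fun w => X^~ w) @^-1` [set (u : I -> U)]) = (\prod_i p (u i))%:E.
Proof.
move=> iX mX pX.
have E : (fun w => X^~ w) @^-1` [set (u : I -> U)] =
    \bigcap_(i in [set` [set: I]%SET]) (X i @^-1` [set u i]).
  apply/seteqP; split => w /=; first by move=> <- i.
  by move=> H; apply/funext => i; apply: H; rewrite /= inE.
rewrite E; split.
  by apply: fin_bigcap_measurable => // i _; exact: mX.
rewrite iX; under [LHS]eq_bigr do rewrite pX.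
by rewrite prodEFin; congr (_%:E); apply: eq_bigl => i; rewrite inE.
Qed.

Lemma hashing_law (R : realType) (disp : measure_display) (T : measurableType disp)
    (P : probability T R) (m n s : nat) (Sh : T -> 'M[R]_(m, n)) :
  random_hashing P s Sh ->
  exists X : T -> {ffun 'I_n -> s.-tuple 'I_m} * {ffun 'I_n * 'I_s -> bool},
    [/\ forall u, measurable (X @^-1` [set u]),
        forall u, P (X @^-1` [set u]) = (hash_weight R u.1 u.2)%:E
      & forall w, Sh w = hash_mx R (X w)].
Proof.
move=> [idx [sgn [uidx usgn [iidx isgn] indep ShE]]].
pose X w : {ffun 'I_n -> s.-tuple 'I_m} * {ffun 'I_n * 'I_s -> bool} :=
  ([ffun j => idx j w], [ffun u => sgn u w]).
have XE t b : X @^-1` [set (t, b)] =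
    ((fun w => idx^~ w) @^-1` [set (t : 'I_n -> _)]) `&`
    ((fun w => sgn^~ w) @^-1` [set (b : 'I_n * 'I_s -> _)]).
  apply/seteqP; split => w /=.
    by rewrite /X => -[<- <-]; split; apply/funext => j; rewrite ffunE.
  by move=> [H1 H2]; congr pair; apply/ffunP => j; rewrite ffunE -?H1 -?H2.
have pidx j t : P (idx j @^-1` [set t]) = (tuple_weight R t)%:E by have [] := uidx j t.
have psgn u b : P (sgn u @^-1` [set b]) = (2^-1)%:E.
  by have [_ ->] := usgn u b; rewrite /= card_bool.
exists X; split.
- move=> [t b]; rewrite XE; apply: measurableI.
    by apply: (prob_independent_family t iidx _ pidx).1 => j v; have [] := uidx j v.
  by apply: (prob_independent_family b isgn _ psgn).1 => j v; have [] := usgn j v.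
- move=> [t b]; rewrite XE indep.
  rewrite (prob_independent_family t iidx _ pidx).2; last by move=> j v; have [] := uidx j v.
  rewrite (prob_independent_family b isgn _ psgn).2; last by move=> j v; have [] := usgn j v.
  by rewrite -EFinM.
- move=> w; rewrite ShE; apply/matrixP => i j; rewrite !mxE /X/=.
  by apply: eq_big => [k|k _]; rewrite !ffunE.
Qed.

Lemma sign_law (R : realType) (disp : measure_display) (T : measurableType disp)
    (P : probability T R) (n : nat) (D : T -> 'M[R]_n) :
  random_sign_diagonal P D ->
  exists Y : T -> {ffun 'I_n -> bool},
    [/\ forall v, measurable (Y @^-1` [set v]),
        forall v, P (Y @^-1` [set v]) = (\prod_(j < n) 2^-1)%:E
      & forall w, D w = sign_diag R (Y w)].
Proof.
move=> [sigma [usig isig DE]].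
pose Y w : {ffun 'I_n -> bool} := [ffun j => sigma j w].
have YE v : Y @^-1` [set v] = (fun w => sigma^~ w) @^-1` [set (v : 'I_n -> bool)].
  apply/seteqP; split => w /=.
    by rewrite /Y => <-; apply/funext => j; rewrite ffunE.
  by move=> H; apply/ffunP => j; rewrite ffunE -H.
have psig j b : P (sigma j @^-1` [set b]) = (2^-1)%:E.
  by have [_ ->] := usig j b; rewrite /= card_bool.
have ms j v : measurable (sigma j @^-1` [set v]) by have [] := usig j v.
exists Y; split.
- by move=> v; rewrite YE; exact: (prob_independent_family v isig ms psig).1.
- by move=> v; rewrite YE; exact: (prob_independent_family v isig ms psig).2.
- by move=> w; rewrite DE; congr diag_mx; apply/rowP => j; rewrite !mxE ffunE.
Qed.

Lemma sign_diag_inj (R : realType) (n : nat) : injective (@sign_diag R n).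
Proof.
move=> f g /matrixP fg; apply/ffunP => j; have := fg j j.
rewrite !mxE eqxx !mulr1n; case: (f j); case: (g j) => //=; rewrite ?expr0 ?expr1 => H.
  by exfalso; lra.
by exfalso; lra.
Qed.

(* Sh and D are independent as random matrices, while X carries more information
   than Sh; replacing X by a function F of Sh makes F and Y independent. *)
Lemma HRHT_prob_ge (R : realType) (disp : measure_display) (T : measurableType disp)
    (P : probability T R) (m n s : nat) (Sh : T -> 'M[R]_(m, n)) (D : T -> 'M[R]_n)
    (Emb : 'M[R]_(m, n) -> 'M[R]_n -> Prop)
    (good : pred {ffun 'I_n -> bool}) (delta delta1 : R) :
  random_hashing P s Sh -> random_sign_diagonal P D -> independent P Sh D ->
  delta <= 1 ->
  (\sum_(v | ~~ good v) \prod_(j < n) 2^-1 <= delta1) ->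
  (forall v, good v -> \sum_(x | ~~ `[< Emb (@hash_mx R m n s x) (sign_diag R v) >])
    hash_weight R x.1 x.2 <= delta) ->
  (((1 - delta) * (1 - delta1))%:E <= P [set w | Emb (Sh w) (D w)])%E.
Proof.
move=> /hashing_law[X [mX pX ShE]] /sign_law[Y [mY pY DE]] indep d1 bad_good bad_hash.
set U := ({ffun 'I_n -> s.-tuple 'I_m} * {ffun 'I_n * 'I_s -> bool})%type.
(* A canonical representative among the realizations that give the same matrix; composed with [X] it
   depends on [Sh] alone. *)
pose c (x : U) : U := odflt x [pick y | hash_mx R y == hash_mx R x].
have hc x : hash_mx R (c x) = hash_mx R x.
  by rewrite /c; case: pickP => [y /eqP|].
have cE x y : hash_mx R x = hash_mx R y -> c x = c y.
  move=> xy; rewrite /c xy; case: pickP => //= none.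
  by have := none y; rewrite eqxx.
pose F w := c (X w).
have FE u : F @^-1` [set u] = if c u == u then Sh @^-1` [set hash_mx R u] else set0.
  apply/seteqP; split => w /=.
    rewrite /F => <-; rewrite ifT; last by apply/eqP/cE/hc.
    by rewrite /= ShE hc.
  by case: eqP => // cu; rewrite /= ShE => /cE; rewrite cu.
have FP u : F @^-1` [set u] = X @^-1` [set x | c x == u].
  by apply/seteqP; split => w /= /eqP.
have mF u : measurable (F @^-1` [set u]).
  by rewrite FP; exact: (fin_preimage_measurable P _ mX).1.
pose p u := fine (P (F @^-1` [set u])).
have pE u : P (F @^-1` [set u]) = (p u)%:E by rewrite fineK// fin_num_measure.
have YE v : Y @^-1` [set v] = D @^-1` [set sign_diag R v].
  apply/seteqP; split => w /=; first by move=> <-; rewrite DE.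
  by rewrite DE => /sign_diag_inj.
pose Z w := (F w, Y w).
have ZE u v : Z @^-1` [set (u, v)] = F @^-1` [set u] `&` Y @^-1` [set v].
  by apply/seteqP; split => w /=; [move=> [-> ->]|move=> [<- <-]].
have mZ z : measurable (Z @^-1` [set z]) by case: z => u v; rewrite ZE; exact: measurableI.
have pZ u v : P (Z @^-1` [set (u, v)]) = (p u * \prod_(j < n) 2^-1)%:E.
  rewrite ZE EFinM -pE -(pY v); have := FE u; case: ifP => _ ->.
    by rewrite YE indep.
  by rewrite set0I measure0 mul0e.
pose G : pred (U * {ffun 'I_n -> bool}) :=
  fun z => `[< Emb (hash_mx R z.1) (sign_diag R z.2) >].
have -> : [set w | Emb (Sh w) (D w)] = Z @^-1` [set z | G z].
  by apply/seteqP; split => w /=; rewrite ShE DE -hc => /asboolP.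
rewrite (fin_preimage_measurable P G mZ).2 lee_fin big_mkcond big_pair/= exchange_big/=.
set h : R := \prod_(j < n) 2^-1.
have h0 : 0 <= h by apply: prodr_ge0 => j _; rewrite invr_ge0.
have hs : \sum_(v : {ffun 'I_n -> bool}) h = 1 by exact: sum_bool_half.
apply: (@le_trans _ _ (\sum_(v | good v) (1 - delta) * h)).
  rewrite -mulr_sumr ler_wpM2l ?subr_ge0// lerBlDl.
  rewrite -hs (bigID good)/= addrC lerD2r; exact: bad_good.
rewrite [leLHS]big_mkcond/=; apply: ler_sum => v _.
have p0 u : 0 <= p u by rewrite fine_ge0.
rewrite (_ : \sum_u _ = (\sum_(u | G (u, v)) p u) * h); last first.
  rewrite mulr_suml [RHS]big_mkcond/=; apply: eq_bigr => u _.
  by case: ifP => // _; rewrite pZ.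
case: ifP => [gv|_]; last by rewrite mulr_ge0// sumr_ge0.
rewrite ler_wpM2r//.
(* [F] and [X] give the same probability to sets of realizations that depend only on the matrix, so
   the bound stated with [hash_weight] transfers to [F]. *)
have H (B : pred U) : (forall x, B (c x) = B x) ->
    \sum_(u | B u) p u = \sum_(x | B x) hash_weight R x.1 x.2.
  move=> Bc; apply: EFin_inj.
  rewrite -(fin_preimage_measurable P B mF).2.
  have -> : F @^-1` [set u | B u] = X @^-1` [set u | B u].
    by apply/seteqP; split => w /=; rewrite /F Bc.
  rewrite (fin_preimage_measurable P B mX).2; congr (_%:E).
  by apply: eq_bigr => x _; rewrite pX.
have p1 : \sum_u p u = 1 by exact: sum_fin_law.
rewrite lerBlDl -p1 (bigID (fun u => G (u, v)))/= addrC lerD2r.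
rewrite (H (fun u => ~~ G (u, v))); first exact: bad_hash.
by move=> x; rewrite /G/= hc.
Qed.

(** * Choice of the constants *)

Lemma even_between (R : realType) (L : R) : 4 <= L ->
  exists p : nat, [/\ (0 < p)%N, ~~ odd p & L <= p%:R <= 2 * L].
Proof.
move=> L4; have L2 : 0 <= L / 2 by lra.
have /andP[k1 k2] := truncn_itv L2.
set k := Num.Def.truncn _ in k1 k2.
(* Here k is the floor of L/2, so this even number lies between L and L + 2 <= 2L. *)
exists (k.+1.*2); split => //; first by rewrite odd_double.
by rewrite -muln2 natrM -(natr1 k); rewrite -(natr1 k) in k2; apply/andP; split; lra.
Qed.

(** The factor exp(-8r) absorbs 64^r because 64 <= 2^8 <= e^8; what remains is delta^2 <= delta. *)
Lemma failure_prob_le (R : realType) (r : nat) (delta : R) :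
  0 < delta -> delta <= 1 ->
  64 ^+ r * expR (- (2 * (4 * r%:R + ln (1 / delta)))) <= delta.
Proof.
move=> d0 d1; rewrite div1r lnV ?posrE//.
rewrite (_ : - _ = r%:R * (- 8) + (ln delta + ln delta)); last by ring.
rewrite !expRD lnK ?posrE// expRM_natl mulrA -exprMn -[leRHS]mul1r.
apply: ler_pM; rewrite ?mulr_ge0 ?(ltW d0) ?exprn_ge0 ?expR_ge0//; last first.
  by rewrite -[leRHS]mul1r ler_wpM2r// ltW.
rewrite exprn_ile1 ?mulr_ge0 ?expR_ge0// expRN ler_pdivrMr ?expR_gt0// mul1r.
apply: (@le_trans _ _ (2 ^+ 8)); first by rewrite -natrX ler_nat.
rewrite -[X in expR X]mulr1 expRM_natl lerXn2r ?nnegrE ?expR_ge0//.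
by have := expR_ge1Dx (1 : R); lra.
Qed.

(** [M] is [mu_bar] stripped of its factor sqrt(C2 eps). Its two branches serve the two conclusions:
    the square root gives M^2 L <= ln E for words on two columns, the other gives M L <= ln(E / (C2
    eps)) for longer ones. Numerically lam nu^2 = e^3 C2 p M^2 / 300, with e^3 C2 <= 1/20. *)
Lemma flatness_constants (R : realType) (E C2 eps L s p M nu : R) :
  C2 = (20 * expR 5)^-1 -> 0 < eps -> eps < 1 -> 0 < s -> 0 < L -> 2 <= E ->
  0 <= p -> p <= 2 * L ->
  M = Num.min (ln (E / (C2 * eps)) / L) (Num.sqrt (ln E / L)) ->
  nu ^+ 2 = 60 * (s * 300^-1 ^+ 2 * (C2 * eps * M ^+ 2)) ->
  let lam := expR 3 * p / (eps / 5 * s) in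
  4 * (lam * nu ^+ 2) <= ln E /\
  lam * nu ^+ 2 * p <= (ln (E / (C2 * eps)) / 6) ^+ 2.
Proof.
move=> C2E eps0 eps1 s0 L0 E2 p0 pL ME -> lam.
have e50 : 0 < expR 5 :> R := expR_gt0 5.
have C20 : 0 < C2 by rewrite C2E invr_gt0 mulr_gt0.
have C21 : C2 <= 1.
  by rewrite C2E invf_le1 ?mulr_gt0//; have := expR_ge1Dx (5 : R); lra.
have Ce0 : 0 < C2 * eps by rewrite mulr_gt0.
have Ce1 : C2 * eps <= 1 by rewrite -[leRHS]mul1r ler_pM// ltW.
set La := ln (E / (C2 * eps)) in ME *.
have La0 : 0 <= La by rewrite ln_ge0// ler_pdivlMr//; lra.
have lE0 : 0 <= ln E by rewrite ln_ge0//; lra.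
have M0 : 0 <= M by rewrite ME le_min sqrtr_ge0 andbT divr_ge0// ltW.
have M1 : M * L <= La by rewrite -ler_pdivlMr// ME ge_min lexx.
have M2 : M ^+ 2 * L <= ln E.
  rewrite -ler_pdivlMr// -[leRHS]sqr_sqrtr; last by rewrite divr_ge0// ltW.
  by rewrite lerXn2r ?nnegrE ?sqrtr_ge0// ME ge_min lexx orbT.
have kap : expR 3 * C2 <= 20^-1.
  rewrite C2E invfM mulrCA -[leRHS]mulr1 ler_wpM2l// ler_pdivrMr// mul1r ler_expR; lra.
have kap0 : 0 <= expR 3 * C2 by rewrite mulr_ge0 ?expR_ge0// ltW.
have lE : lam * (60 * (s * 300^-1 ^+ 2 * (C2 * eps * M ^+ 2))) =
    expR 3 * C2 * (p * M ^+ 2 / 300).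
  by rewrite /lam; field; rewrite !lt0r_neq0.
rewrite lE; split.
  have H : p * M ^+ 2 <= 2 * ln E.
    apply: (@le_trans _ _ (2 * (M ^+ 2 * L))); last by rewrite ler_pM2l.
    by rewrite (_ : 2 * _ = 2 * L * M ^+ 2); [rewrite ler_wpM2r ?sqr_ge0|ring].
  have H0 : 0 <= p * M ^+ 2 / 300 by rewrite divr_ge0// mulr_ge0// sqr_ge0.
  have := ler_wpM2r H0 kap; lra.
have H : p * M <= 2 * La.
  apply: (@le_trans _ _ (2 * (M * L))); last by rewrite ler_pM2l.
  by rewrite (_ : 2 * _ = 2 * L * M); [rewrite ler_wpM2r|ring].
have H2 : (p * M) ^+ 2 <= (2 * La) ^+ 2 by rewrite lerXn2r ?nnegrE ?mulr_ge0.
rewrite (_ : _ * p = expR 3 * C2 * ((p * M) ^+ 2 / 300)); last by field.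
have H0 : 0 <= (p * M) ^+ 2 / 300 by rewrite divr_ge0// sqr_ge0.
apply: le_trans (ler_wpM2r H0 kap) _.
have : 0 <= La ^+ 2 by exact: sqr_ge0.
move: H2; rewrite !exprMn; lra.
Qed.

Theorem theorem2p4p4 (R : realType) :
  exists C1 C2 C3 CM Cnu Cs : R,
    (0 < C1 /\ 0 < C2 /\ 0 < C3 /\ 0 < CM /\ 0 < Cnu /\ 0 < Cs) /\
    forall (r d n : nat) (eps delta : R) (m s : nat) (E delta1 : R),
      (0 < r)%N -> (r <= d)%N -> (d <= n)%N ->
      (exists k : nat, n = (2 ^ k)%N) ->
      0 < eps -> eps < C3 -> 0 < delta -> delta < C3 ->
      (0 < m)%N -> (0 < s)%N -> (m <= n)%N -> 0 < E ->
      s%:R <= Cs * C2^-1 * eps^-1 * (4 * r%:R + ln (1 / delta)) ->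
      CM <= E ->
      E <= C2 ^+ 2 * eps ^+ 2 * s%:R * (4 * r%:R + ln (1 / delta))^-1 *
           expR (Cs * (C2 * eps * s%:R)^-1 * (4 * r%:R + ln (1 / delta))) ->
      m%:R >= Num.max
        (E * C2 ^- 2 * eps ^- 2 * (4 * r%:R + ln (1 / delta)))
        (s%:R * expR 1) ->
      0 < delta1 -> delta1 < 1 ->
      n%:R >= (Num.sqrt r%:R + Num.sqrt (8 * ln (n%:R / delta1))) ^+ 2 /
              (s%:R * Cnu ^+ 2 * C1 ^- 2 * mu_bar C1 C2 E eps delta r ^+ 2) ->
      forall A : 'M[R]_(n, d), \rank A = r ->
      forall (disp : measure_display) (T : measurableType disp)
             (P : probability T R) (S : T -> 'M[R]_(m, n)),
        random_HRHT P s S ->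
        (((1 - delta) * (1 - delta1))%:E <=
           P [set w | subspace_embedding eps (S w) A])%E.
Proof.
(* Chosen so that [10 * expR 5 * C2] is exactly 1/2, the ratio of the geometric series over the
   number of columns. *)
pose C2 : R := (20 * expR 5)^-1.
have C20 : 0 < C2 by rewrite invr_gt0 mulr_gt0// expR_gt0.
exists 1, C2, 1, 2, 300^-1, 1; split; first by do !split => //; rewrite invr_gt0.
move=> r d n eps delta m s E delta1 r0 _ _ [k nk] eps0 eps1 d0 d1 m0 s0 _ _ _ E2 _.
set L := 4 * r%:R + ln (1 / delta).
move=> mL d10 d11 nL A rA disp T P S [Sh [D [hSh hD indep SE]]].
have rR : 1 <= r%:R :> R by rewrite ler1n.
have L4 : 4 <= L.
  have : 0 <= ln (1 / delta) by rewrite ln_ge0// div1r invf_ge1// ltW.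
  by rewrite /L; lra.
have L0 : 0 < L by lra.
have sR : 0 < s%:R :> R by rewrite ltr0n.
have n0 : (0 < n)%N by rewrite nk expn_gt0.
have nR : 0 < n%:R :> R by rewrite ltr0n.
have mR : 0 < m%:R :> R by rewrite ltr0n.
have e51 : 1 <= expR 5 :> R by have := expR_ge1Dx (5 : R); lra.
have C21 : C2 <= 1 by rewrite invf_le1; lra.
have Ce : C2 * eps <= 1 by rewrite -[leRHS]mul1r ler_pM// ltW.
have Ce0 : 0 < C2 * eps by rewrite mulr_gt0.
have [p [p0 ep /andP[Lp pL]]] := even_between L4.
move: mL; rewrite ge_max => /andP[mE ms].
have sm : (s <= m)%N.
  rewrite -(ler_nat R); apply: le_trans ms; rewrite ler_peMr ?ltW//.
  by have := expR_ge1Dx (1 : R); lra.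
have {}mE : E * L <= m%:R * C2 ^+ 2 * eps ^+ 2.
  have H : 0 < C2 ^+ 2 * eps ^+ 2 by rewrite mulr_gt0// exprn_gt0.
  rewrite -(ler_pM2r H) in mE; rewrite -mulrA; apply: le_trans mE.
  rewrite le_eqVlt; apply/orP; left; apply/eqP.
  by field; rewrite !lt0r_neq0.
pose M : R := Num.min (ln (E / (C2 * eps)) / L) (Num.sqrt (ln E / L)).
have M0 : 0 < M.
  rewrite lt_min; apply/andP; split; last by rewrite sqrtr_gt0 divr_gt0// ln_gt0//; lra.
  by rewrite divr_gt0// ln_gt0// ltr_pdivlMr//; lra.
pose q0 : R := s%:R * 300^-1 ^+ 2 * (C2 * eps * M ^+ 2).
have q00 : 0 < q0 by rewrite !mulr_gt0// ?exprn_gt0// invr_gt0.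
(* [q0] is the denominator in the condition on n, which therefore gives n q0 >= r + 8 log(n/delta1)
   once the cross term is dropped; the factor 60 turns r into the 60 r of the union bound over the
   net. *)
pose nu := Num.sqrt (60 * q0).
have nu2 : nu ^+ 2 = 60 * q0 by rewrite sqr_sqrtr// mulr_ge0// ltW.
have nu_n : 8 * ln (n%:R / delta1) + 60 * r%:R <= n%:R * nu ^+ 2.
  have l0 : 0 <= ln (n%:R / delta1).
    rewrite ln_ge0// ler_pdivlMr// mul1r; apply: le_trans (ltW d11) _.
    by rewrite ler1n.
  move: nL; rewrite /mu_bar -/L -/M.
  rewrite (_ : s%:R * _ * _ * _ = q0); last first.
    rewrite /q0 expr1n invr1 mulr1 mul1r !exprMn !sqr_sqrtr ?ltW//.
  rewrite ler_pdivrMr// sqrrD sqr_sqrtr// sqr_sqrtr ?mulr_ge0// => nL.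
  have : 0 <= Num.sqrt r%:R * Num.sqrt (8 * ln (n%:R / delta1)) *+ 2.
    by rewrite mulrn_wge0// mulr_ge0// sqrtr_ge0.
  rewrite nu2 mulrCA; lra.
have [bE bp] := flatness_constants (erefl C2) eps0 eps1 sR L0 E2 (ler0n R p) pL
  (erefl M) nu2.
subst r; have [W [B [WW AE]]] := orthonormal_factor A.
pose H := walsh_hadamard R n.
have HH : H^T *m H = 1%:M by have := walsh_hadamard_orthogonal R k; rewrite -nk.
have -> : [set w | subspace_embedding eps (S w) A] =
    [set w | subspace_embedding eps (Sh w *m (H *m D w)) A].
  by apply/seteqP; split => w /=; rewrite SE mulmxA.
apply: (@HRHT_prob_ge R disp T P m n s Sh D
  (fun M N => subspace_embedding eps (M *m (H *m N)) A)
  (fun v => flat_on_net (H *m sign_diag R v *m W) nu)) => //; first exact: ltW.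
  by apply: sign_bad_weight => //; exact: sqrtr_ge0.
move=> v flat; apply: le_trans (failure_prob_le (\rank A) d0 (ltW d1)).
apply: (@hash_bad_weight R m n s p _ _ _ W A B nu (ln (E / (C2 * eps)) / 6) E C2) => //.
- rewrite divr_ge0// ln_ge0// ler_pdivlMr//; lra.
- by lra.
- rewrite /C2 invfM le_eqVlt; apply/orP; left; apply/eqP; field.
  by rewrite lt0r_neq0// expR_gt0.
- by rewrite Lp.
- by lra.
- rewrite trmx_mul mulmxA -(mulmxA _^T) HH mulmx1.
  exact: sign_diag_orthogonal.
Qed.
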